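(* Let $\lambda/\mu$ be an edgewise connected skew shape with $d$ diagonals, and let $\Pi$ be an outside decomposition of $\lambda/\mu$. Then for each diagonal of $\lambda/\mu$, with content $i$ say, the determinant $D(\omega_i(\Pi))$ can be obtained from the determinant $D(\Pi)$ by elementary determinantal operations.
   Context: Skew shapes. For partitions $\lambda=(\lambda_1\ge\dots\ge\lambda_k\ge 0)$, $\mu=(\mu_1\ge\dots\ge\mu_k\ge 0)$ with $\mu_i\le\lambda_i$ for all $i$, the skew diagram (skew shape) $\lambda/\mu$ is the set of boxes $(i,j)\in\mathbb{Z}^2$ with $1\le i\le k$, $\mu_i<j\le\lambda_i$; box $(i,j)$ lies in row $i$ from the top and column $j$ from the left. Two boxes are edgewise connected if they share a common edge; the diagram is edgewise connected if it is a (nonempty) connected set under this adjacency. The content of $(i,j)$ is $j-i$; a diagonal with content $c$ is the set of all boxes of $\lambda/\mu$ with content $c$ (only nonempty diagonals are counted). Diagonals are ordered by increasing content; for an edgewise connected shape the contents occurring are consecutive integers. Border strips. A (border) strip is an edgewise connected skew diagram (considered up to translation when regarded as an abstract shape) containing no $2\times2$ block of boxes. Its starting box is the box at its lower left end, its ending box is at its upper right end, and boxes are ordered by increasing content. A box that is not the ending box goes right if the next box is to its right, and goes up if the next box is above it. Outside decompositions. A border strip decomposition of $\lambda/\mu$ is a partition of its boxes into pairwise disjoint strips. It is an outside decomposition if every strip has its starting box on the left or bottom perimeter of $\lambda/\mu$ (its left or lower neighbour is not in $\lambda/\mu$) and its ending box on the right or top perimeter of $\lambda/\mu$ (its right or upper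 neighbour is not in $\lambda/\mu$). For a strip $\theta$ of $\Pi$, $p(\theta)$ and $q(\theta)$ denote the contents of its starting box and its ending box. The ending contents of the strips of $\Pi$ are distinct (as are the starting contents), and one writes $\Pi=(\theta_1,\dots,\theta_m)$ with $q(\theta_1)>\dots>q(\theta_m)$. Directions. Given an outside decomposition $\Pi$ and a box $b$ in the strip $\theta\in\Pi$: if $b$ is not the ending box of $\theta$, $b$ goes right (resp. up) in $\lambda/\mu$ if it does so in $\theta$. If $b$ is the ending box of $\theta$, it goes up if it is on the top perimeter of $\lambda/\mu$ (including when it is a corner), and otherwise (it is on the right perimeter) it goes right. It is a known fact (Hamel and Goulden's nested property) that the boxes on the same diagonal of $\lambda/\mu$ all go up or all go right. Cutting strip. The cutting strip $\phi$ of $\Pi$ is the border strip with $d$ boxes such that, for $t=1,\dots,d-1$, its $t$-th box goes right or up according to whether the boxes in the $t$-th diagonal of $\lambda/\mu$ go right or up with respect to $\Pi$. Its $t$-th box is assigned the content of the $t$-th diagonal of $\lambda/\mu$. The map from outside decompositions of $\lambda/\mu$ to border strips with $d$ boxes, $\Pi\mapsto\phi$, is a bijection. For integers $p,q$ write $\phi[p,q]$ for: the segment of $\phi$ from its box of content $p$ to its box of content $q$ if $p\le q$; the empty strip $\varnothing$ if $p=q+1$; undefined if $p>q+1$. Twist transformation. $\omega_i(\Pi)$ is the outside decomposition of $\lambda/\mu$ obtained from $\Pi$ by changing the direction of the boxes on the diagonal with content $i$; that is, its cutting strip is obtained from that of $\Pi$ by changing the direction (up $\leftrightarrow$ right) of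 the box with content $i$ and keeping all other directions. (For the last diagonal, whose box has no successor in the cutting strip, $\omega_i(\Pi)=\Pi$.) Determinant. For a skew diagram $I$, $s_I=s_I(X)$ is the skew Schur function in the variables $X=\{x_1,x_2,\dots\}$, with $s_\varnothing=1$, and $s$ of an undefined strip equal to $0$. For $\Pi=(\theta_1,\dots,\theta_m)$ with cutting strip $\phi$, $$D(\Pi)=\det\left[\,s_{\phi[p(\theta_j),\,q(\theta_i)]}\,\right]_{i,j=1}^m ,$$ where $i$ is the row index and $j$ is the column index (this is the Hamel–Goulden determinant, whose $(i,j)$ entry is the Schur function of the strip $\theta_i\#\theta_j=\phi[p(\theta_j),q(\theta_i)]$). Elementary determinantal operations, performed on determinants of matrices with entries in the ring of symmetric functions (keeping track of the resulting signs and scalar factors), are: (1) interchanging two rows or two columns; (2) multiplying a row or a column by a non-zero scalar, or adding a multiple (by an element of the ring) of one row or column to another row or column, respectively; (3) forming from two determinants a bigger determinant by forming the bigger block diagonal matrix, or reducing the determinant of a block diagonal matrix to two smaller determinants, one of which may be that of an identity matrix. *)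

(* Defs.v *)
From HB Require Import structures.
From Stdlib Require Import Relation_Operators.
From mathcomp Require Import all_boot all_order all_algebra.
From mathcomp Require Import finmap boolp mpoly.

Set Implicit Arguments.
Unset Strict Implicit.
Unset Printing Implicit Defensive.

Import Order.TTheory GRing.Theory Num.Theory.
Local Open Scope fset_scope.
Local Open Scope ring_scope.

(* (i, j) is the box in row i, counted from the top, and column j. *)
Definition box : Type := (int * int)%type.

Definition content (b : box) : int := b.2 - b.1.

Definition up_of (b : box) : box := (b.1 - 1, b.2).
Definition down_of (b : box) : box := (b.1 + 1, b.2).
Definition left_of (b : box) : box := (b.1, b.2 - 1).
Definition right_of (b : box) : box := (b.1, b.2 + 1).

Definition partition_pair (k : nat) (lam mu : k.-tuple nat) : Prop :=
  [/\ sorted geq lam, sorted geq mu & forall r : 'I_k, (tnth mu r <= tnth lam r)%N].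

(* Rows and columns are numbered from 1: the boxes of the r-th row (r < k) are
   the (r + 1, c) with mu_r < c <= lam_r. *)
Definition skew_shape (k : nat) (lam mu : k.-tuple nat) : {fset box} :=
  [fset b in flatten
     [seq [seq ((r : nat).+1%:Z, c%:Z) | c <- iota (tnth mu r).+1 (tnth lam r - tnth mu r)]
      | r : 'I_k]].

Definition translate (v : box) (D : {fset box}) : {fset box} :=
  [fset (b.1 + v.1, b.2 + v.2) | b in D].

Definition is_skew_diagram (D : {fset box}) : Prop :=
  exists (k : nat) (lam mu : k.-tuple nat) (v : box),
    partition_pair lam mu /\ D = translate v (skew_shape lam mu).

Definition share_edge (a b : box) : bool :=
  b \in [:: up_of a; down_of a; left_of a; right_of a].

Definition edgewise_connected (D : {fset box}) : bool :=
  (D != fset0) &&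
  [forall a : D, forall b : D, connect (fun x y : D => share_edge (val x) (val y)) a b].

Definition has_square (D : {fset box}) : Prop :=
  exists b : box,
    [/\ b \in D, right_of b \in D, down_of b \in D & right_of (down_of b) \in D].

Definition is_strip (D : {fset box}) : Prop :=
  [/\ is_skew_diagram D, edgewise_connected D & ~ has_square D].

(* The contents of the nonempty diagonals, in increasing order. *)
Definition diagonals (D : {fset box}) : seq int :=
  sort <=%R (undup [seq content b | b <- D]).

Definition start_content (th : {fset box}) : int := head 0 (diagonals th).
Definition end_content (th : {fset box}) : int := last 0 (diagonals th).

Definition outside_decomposition (D : {fset box}) (Pi : {fset {fset box}}) : Prop :=
  [/\ {in Pi, forall th, is_strip th},
      {in Pi &, forall th th', th != th' -> [disjoint th & th']},
      \bigcup_(th <- Pi) th = D,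
      {in Pi, forall th, forall b, b \in th -> content b = start_content th ->
         (left_of b \notin D) || (down_of b \notin D)} &
      {in Pi, forall th, forall b, b \in th -> content b = end_content th ->
         (right_of b \notin D) || (up_of b \notin D)}].

(* A strip has one box of each content, so a box b of th other than its ending
   box is followed in th by up_of b or by right_of b. *)
Definition goes_up (D : {fset box}) (Pi : {fset {fset box}}) (b : box) : bool :=
  [exists th : Pi, (b \in val th) &&
     (if content b == end_content (val th) then up_of b \notin D
      else up_of b \in val th)].

(* By the nested property of Hamel and Goulden, all the boxes on a diagonal go
   in the same direction; the existential then reads off this direction. *)
Definition diagonal_goes_up (D : {fset box}) (Pi : {fset {fset box}}) (c : int) : bool :=
  [exists b : D, (content (val b) == c) && goes_up D Pi (val b)].

(* Directions of all the diagonals but the last; true means up. *)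
Definition directions (D : {fset box}) (Pi : {fset {fset box}}) : seq bool :=
  [seq diagonal_goes_up D Pi c | c <- take (size (diagonals D)).-1 (diagonals D)].

(* The strip with given directions, placed so that its starting box has
   content c. *)
Definition strip_along (c : int) (ups : seq bool) : {fset box} :=
  let b0 : box := (0, c) in
  [fset b in b0 :: scanl (fun (b : box) (u : bool) => if u then up_of b else right_of b) b0 ups].

(* When D is edgewise connected its contents are consecutive, so the t-th box
   of the cutting strip has as geometric content that of the t-th diagonal. *)
Definition cutting_strip (D : {fset box}) (Pi : {fset {fset box}}) : {fset box} :=
  strip_along (start_content D) (directions D Pi).

(* If i is the last diagonal, ups has no entry for it and nothing changes. *)
Definition flip_direction (D : {fset box}) (i : int) (ups : seq bool) : seq bool :=
  [seq cu.2 (+) (cu.1 == i) | cu <- zip (diagonals D) ups].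

(* Pi' is omega_i(Pi). *)
Definition is_twist (D : {fset box}) (i : int) (Pi Pi' : {fset {fset box}}) : Prop :=
  outside_decomposition D Pi' /\
  cutting_strip D Pi' =
    strip_along (start_content D) (flip_direction D i (directions D Pi)).

(* None is the undefined strip. *)
Definition segment (phi : {fset box}) (p q : int) : option {fset box} :=
  if p <= q then Some [fset b in phi | p <= content b <= q]
  else if p == q + 1 then Some fset0 else None.

(* A function of x_1, x_2, ... is represented by the sequence of its
   specializations to x_1, ..., x_n, n >= 0, with pointwise operations. The ring
   of symmetric functions over the rationals is the subalgebra singled out by
   is_symmetric_function below: symmetric polynomials of bounded degree,
   compatible with the restrictions x_(n+1) = 0. *)
Definition varpoly : Type := forall n : nat, {mpoly rat[n]}.

HB.instance Definition _ := Choice.copy varpoly (forall n : nat, {mpoly rat[n]}).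

Section VarpolyAlgebra.
Implicit Types f g h : varpoly.

Let zero : varpoly := fun=> 0.
Let one : varpoly := fun=> 1.
Let opp f : varpoly := fun n => - f n.
Let add f g : varpoly := fun n => f n + g n.
Let mul f g : varpoly := fun n => f n * g n.
Let scale (a : rat) f : varpoly := fun n => a *: f n.

Fact varpoly_addA : associative add.
Proof. by move=> f g h; apply: functional_extensionality_dep => n; exact: addrA. Qed.
Fact varpoly_addC : commutative add.
Proof. by move=> f g; apply: functional_extensionality_dep => n; exact: addrC. Qed.
Fact varpoly_add0 : left_id zero add.
Proof. by move=> f; apply: functional_extensionality_dep => n; exact: add0r. Qed.
Fact varpoly_addN : left_inverse zero opp add.
Proof. by move=> f; apply: functional_extensionality_dep => n; exact: addNr. Qed.

HB.instance Definition _ := GRing.isZmodule.Build varpoly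
  varpoly_addA varpoly_addC varpoly_add0 varpoly_addN.

Fact varpoly_mulA : associative mul.
Proof. by move=> f g h; apply: functional_extensionality_dep => n; exact: mulrA. Qed.
Fact varpoly_mulC : commutative mul.
Proof. by move=> f g; apply: functional_extensionality_dep => n; exact: mulrC. Qed.
Fact varpoly_mul1 : left_id one mul.
Proof. by move=> f; apply: functional_extensionality_dep => n; exact: mul1r. Qed.
Fact varpoly_mulDl : left_distributive mul +%R.
Proof. by move=> f g h; apply: functional_extensionality_dep => n; exact: mulrDl. Qed.
Fact varpoly_one_neq0 : one != 0 :> varpoly.
Proof. by apply/eqP => /(congr1 (fun f : varpoly => f 0%N)) /eqP; exact/negP/oner_neq0. Qed.

HB.instance Definition _ := GRing.Zmodule_isComNzRing.Build varpoly
  varpoly_mulA varpoly_mulC varpoly_mul1 varpoly_mulDl varpoly_one_neq0.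

Fact varpoly_scaleA a b f : scale a (scale b f) = scale (a * b) f.
Proof. by apply: functional_extensionality_dep => n; exact: scalerA. Qed.
Fact varpoly_scale1 : left_id 1 scale.
Proof. by move=> f; apply: functional_extensionality_dep => n; exact: scale1r. Qed.
Fact varpoly_scaleDr : right_distributive scale +%R.
Proof. by move=> a f g; apply: functional_extensionality_dep => n; exact: scalerDr. Qed.
Fact varpoly_scaleDl f : {morph scale^~ f : a b / a + b}.
Proof. by move=> a b; apply: functional_extensionality_dep => n; exact: scalerDl. Qed.

HB.instance Definition _ := GRing.Zmodule_isLmodule.Build rat varpoly
  varpoly_scaleA varpoly_scale1 varpoly_scaleDr varpoly_scaleDl.

Fact varpoly_scaleAl (a : rat) f g : a *: (f * g) = (a *: f) * g.
Proof. by apply: functional_extensionality_dep => n; exact: scalerAl. Qed.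

HB.instance Definition _ := GRing.Lmodule_isLalgebra.Build rat varpoly varpoly_scaleAl.
HB.instance Definition _ := GRing.Lalgebra_isComAlgebra.Build rat varpoly.

End VarpolyAlgebra.

(* Sets the last variable to 0. *)
Definition drop_last_var (n : nat) (p : {mpoly rat[n.+1]}) : {mpoly rat[n]} :=
  p \mPo [tuple (if unlift ord_max i is Some j then 'X_j else 0) | i < n.+1].

Definition is_symmetric_function (f : varpoly) : Prop :=
  [/\ forall n, f n \is symmetric,
      forall n, drop_last_var (f n.+1) = f n &
      exists d : nat, forall n, (msize (f n) <= d)%N].

Definition semistandard (D : {fset box}) (n : nat) (T : {ffun D -> 'I_n}) : bool :=
  [forall a : D, forall b : D,
     (((val a).1 == (val b).1) && ((val a).2 < (val b).2) ==> (T a <= T b)%N) &&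
     (((val a).2 == (val b).2) && ((val a).1 < (val b).1) ==> (T a < T b)%N)].

Definition skew_schur (D : {fset box}) : varpoly :=
  fun n => \sum_(T : {ffun D -> 'I_n} | semistandard T) \prod_(b : D) 'X_(T b).

Definition schur_option (D : option {fset box}) : varpoly :=
  if D is Some E then skew_schur E else 0.

(* The strips theta_1, ..., theta_m, by decreasing ending content. *)
Definition strips (Pi : {fset {fset box}}) : seq {fset box} :=
  sort (fun th th' => end_content th' <= end_content th) Pi.

Definition strip_matrix (D : {fset box}) (Pi : {fset {fset box}}) :
    'M[varpoly]_(size (strips Pi)) :=
  \matrix_(i, j) schur_option
    (segment (cutting_strip D Pi)
       (start_content (nth fset0 (strips Pi) j))
       (end_content (nth fset0 (strips Pi) i))).

Section ElementaryOperations.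
(* S is a subalgebra of R, the ring in which the operations take place: only
   multiples by elements of S are added, so that matrices with entries in S are
   turned into matrices with entries in S. *)
Variables (K : fieldType) (R : comAlgType K) (S : R -> Prop).

(* row_op A f B: one row operation turns A into B, and \det A = f *: \det B. *)
Inductive row_op (n : nat) (A : 'M[R]_n) : K -> 'M[R]_n -> Prop :=
| RowSwap r s of r != s : row_op A (-1) (xrow r s A)
| RowScale r (a : K) of a != 0 :
    row_op A a^-1 (\matrix_(i, j) (if i == r then a *: A i j else A i j))
| RowAdd r s (a : R) of r != s & S a :
    row_op A 1 (\matrix_(i, j) (if i == r then A i j + a * A s j else A i j)).

(* (c, [:: A1; ...; Ar]) stands for the expression
   c *: (\det A1 * ... * \det Ar), whose value every step preserves. *)
Definition det_expr : Type := (K * seq {n : nat & 'M[R]_n})%type.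

Definition mx (n : nat) (A : 'M[R]_n) : {n : nat & 'M[R]_n} := existT _ n A.

Inductive det_step : det_expr -> det_expr -> Prop :=
| StepRow c l1 l2 n (A B : 'M[R]_n) f of row_op A f B :
    det_step (c, l1 ++ mx A :: l2) (c * f, l1 ++ mx B :: l2)
| StepCol c l1 l2 n (A B : 'M[R]_n) f of row_op A^T f B^T :
    det_step (c, l1 ++ mx A :: l2) (c * f, l1 ++ mx B :: l2)
| StepJoin c l1 l2 m n (A : 'M[R]_m) (B : 'M[R]_n) :
    det_step (c, l1 ++ mx A :: mx B :: l2) (c, l1 ++ mx (block_mx A 0 0 B) :: l2)
| StepSplit c l1 l2 m n (A : 'M[R]_m) (B : 'M[R]_n) :
    det_step (c, l1 ++ mx (block_mx A 0 0 B) :: l2) (c, l1 ++ mx A :: mx B :: l2)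
| StepInsert1 c l1 l2 n :
    det_step (c, l1 ++ l2) (c, l1 ++ mx (1%:M : 'M[R]_n) :: l2)
| StepDelete1 c l1 l2 n :
    det_step (c, l1 ++ mx (1%:M : 'M[R]_n) :: l2) (c, l1 ++ l2).

Definition det_obtainable (m n : nat) (A : 'M[R]_m) (B : 'M[R]_n) : Prop :=
  clos_refl_trans det_expr det_step (1, [:: mx A]) (1, [:: mx B]).

End ElementaryOperations.

(* Main.v *)
Require Import Defs.
From Stdlib Require Import Relation_Operators.
From mathcomp Require Import all_boot all_order all_algebra.
From mathcomp Require Import finmap boolp mpoly perm zify ring.

Set Implicit Arguments.
Unset Strict Implicit.
Unset Printing Implicit Defensive.

Import Order.TTheory GRing.Theory Num.Theory.
Local Open Scope ring_scope.

(** Write [f p q] for the Schur function of the segment [phi[p, q]] of the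
    cutting strip [phi], so that the matrix of [Pi] has the entry [f p q] in the
    column of the strip starting at [p] and the row of the strip ending at [q].
    Only the direction of [phi] on the diagonal [i] changes under the twist, to
    give entries [f' p q].  Entries with [q <= i] or [p > i] do not see the
    change, and for [p <= i < q] cutting a filling of a strip between the contents
    [i] and [i + 1] gives ([ribbon_split], [schur_entry_split])

      [f p i * f (i + 1) q = f p q + f' p q].

    Hence [f' p q] is minus [f p q] plus a multiple of the row ending at [i], or
    plus a multiple of the column starting at [i + 1]: negating some rows and
    columns and adding multiples of one line turns one matrix into the other, if
    such a line is present.  Which one is present depends on the shape.  The
    diagonals [i] and [i + 1] occupy intervals of rows, and the top and the bottom
    of the interval move up by at most one row.
    - If the diagonal gets shorter, exactly one strip ends at [i] in both
      decompositions and none starts at [i + 1] ([twist_at_end]).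
    - If it gets longer, exactly one strip starts at [i + 1] in both and none ends
      at [i] ([twist_at_start]).
    - If the lengths agree, one of the two decompositions has both a strip ending
      at [i] and a strip starting at [i + 1], the other has neither, and an
      identity block supplies the missing row and column ([twist_new]).

    The signs have to come out right too.  Rows are listed by decreasing ending
    content, and the columns are then in the order of the strips, so a twist also
    permutes columns.  The parity of this permutation is found by sweeping the
    diagonals from left to right ([swept]): keep the starts of the strips met so
    far, first those of the current diagonal from bottom to top, then those of the
    finished strips, the most recent first.  A diagonal whose boxes go up moves no
    start past another, and one whose boxes go right may take its bottom strip, or
    a new top strip, past the others.  So each diagonal contributes a sign that
    depends only on its direction and on the shape ([swept_parity]); comparing the
    two sweeps gives [ascents_twist], which cancels the signs of the negated rows
    and columns ([count_crossing]).

    All this needs that the strips follow the common direction of their diagonals.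
    This is the nested property of Hamel and Goulden, [goes_up_next] and its
    consequences [is_end] and [is_start].  Finally, the multipliers are symmetric
    functions because ribbon Schur functions are obtained from products of
    elementary symmetric ones by the same identity ([ribbon_symmetric]). *)

(** * Elementary operations on determinants *)

Section ElementaryOperationsTheory.
Variables (K : fieldType) (R : comAlgType K) (S : R -> Prop).

Definition reachable : det_expr R -> det_expr R -> Prop :=
  clos_refl_trans _ (det_step S).

Lemma reachable_trans : forall y x z, reachable x y -> reachable y z -> reachable x z.
Proof. by move=> y x z; exact: rt_trans. Qed.

(** Row and column operations on one determinant, kept apart from the block
    operations because they do not change the size and are exchanged by
    transposition, which gives the column versions of the lemmas for rows. *)
Inductive ops (n : nat) : 'M[R]_n -> K -> 'M[R]_n -> Prop :=
| OpsRefl A : ops A 1 A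
| OpsRow A f B g C of row_op S A f B & ops B g C : ops A (f * g) C
| OpsCol A f B g C of row_op S A^T f B^T & ops B g C : ops A (f * g) C.

Lemma ops_trans n (A B C : 'M_n) f g : ops A f B -> ops B g C -> ops A (f * g) C.
Proof.
elim=> {A f B} [A | A f B f' C' h _ IH | A f B f' C' h _ IH] hg.
- by rewrite mul1r.
- by rewrite -mulrA; exact: OpsRow h (IH hg).
- by rewrite -mulrA; exact: OpsCol h (IH hg).
Qed.

Lemma row_op_ops n (A B : 'M_n) f : row_op S A f B -> ops A f B.
Proof. by move=> h; rewrite -[f]mulr1; apply: OpsRow h (OpsRefl _). Qed.

Lemma ops_tr n (A B : 'M_n) f : ops A f B -> ops A^T f B^T.
Proof.
elim=> {A f B} [A | A f B f' C' h _ IH | A f B f' C' h _ IH].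
- exact: OpsRefl.
- by apply: OpsCol IH; rewrite !trmxK.
- by apply: OpsRow IH.
Qed.

Lemma ops_reachable n (A B : 'M_n) f c l1 l2 :
  ops A f B -> reachable (c, l1 ++ mx A :: l2) (c * f, l1 ++ mx B :: l2).
Proof.
move=> h; elim: h c => {A f B} [A | A f B f' C' h _ IH | A f B f' C' h _ IH] c.
- by rewrite mulr1; exact: rt_refl.
- rewrite mulrA; apply: reachable_trans (IH _).
  by apply: rt_step; exact: StepRow.
- rewrite mulrA; apply: reachable_trans (IH _).
  by apply: rt_step; exact: StepCol.
Qed.

Section Reversal.
Hypothesis S_opp : forall a, S a -> S (- a).

Lemma row_op_rev n (A B : 'M_n) f :
  row_op S A f B -> f != 0 /\ row_op S B f^-1 A.
Proof.
case=> [r s rs | r a a0 | r s a rs Sa].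
- split; first by rewrite oppr_eq0 oner_eq0.
  have -> : (-1)^-1 = -1 :> K by rewrite invrN invr1.
  have := RowSwap S (xrow r s A) rs.
  suff -> : xrow r s (xrow r s A) = A by [].
  by apply/matrixP=> i j; rewrite !mxE tpermK.
- split; first by rewrite invr_eq0.
  set B' := \matrix_(_, _) _.
  have ai0 : a^-1 != 0 by rewrite invr_eq0.
  have := RowScale S B' r ai0; congr row_op; apply/matrixP=> i j; rewrite !mxE.
  by case: eqP => //; rewrite scalerA mulVf // scale1r.
- split; first exact: oner_neq0.
  rewrite invr1; set B' := \matrix_(_, _) _.
  have := RowAdd B' rs (S_opp Sa); congr row_op; apply/matrixP=> i j.
  by rewrite !mxE [s == r]eq_sym (negPf rs); case: eqP => // ->; rewrite mulNr addrK.
Qed.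

Lemma det_step_rev x y : det_step S x y -> reachable y x.
Proof.
case=> [c l1 l2 n A B f h | c l1 l2 n A B f h | c l1 l2 m n A B | c l1 l2 m n A B
       | c l1 l2 n | c l1 l2 n].
- have [f0 h'] := row_op_rev h; apply: rt_step.
  by rewrite -[X in (X, _ ++ mx A :: _)](mulfK f0 c); exact: StepRow.
- have [f0 h'] := row_op_rev h; apply: rt_step.
  by rewrite -[X in (X, _ ++ mx A :: _)](mulfK f0 c); exact: StepCol.
- by apply: rt_step; exact: StepSplit.
- by apply: rt_step; exact: StepJoin.
- by apply: rt_step; exact: StepDelete1.
- by apply: rt_step; exact: StepInsert1.
Qed.

(** Inverting a chain of operations lets the twist that removes a strip be
    deduced from the twist that adds one. *)
Lemma reachable_sym x y : reachable x y -> reachable y x.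
Proof.
elim=> {x y} [x y | x | x y z _ hyx _ hzy].
- exact: det_step_rev.
- exact: rt_refl.
- exact: reachable_trans hzy hyx.
Qed.
End Reversal.

(** Rows are negated one at a time, each at the cost of a sign. *)
Lemma ops_neg_rows n (A : 'M_n) (U : pred 'I_n) :
  ops A ((-1) ^+ #|U|) (\matrix_(i, j) (if U i then - A i j else A i j)).
Proof.
suff H (e : seq 'I_n) : uniq e ->
    ops A ((-1) ^+ size e) (\matrix_(i, j) (if i \in e then - A i j else A i j)).
  have := H (enum U) (enum_uniq _); rewrite -cardE.
  by congr ops; apply/matrixP=> i j; rewrite !mxE mem_enum.
elim: e => [|r e IH] /=.
  move=> _; set B := \matrix_(_, _) _.
  suff -> : B = A by exact: OpsRefl.
  by apply/matrixP=> i j; rewrite mxE.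
case/andP=> re /IH {}IH; rewrite exprSr; apply: (ops_trans IH).
apply: row_op_ops; set B := \matrix_(_, _) _; set C := \matrix_(_, _) _.
have -> : C = \matrix_(i, j) (if i == r then (-1) *: B i j else B i j).
  apply/matrixP=> i j; rewrite !mxE inE; case: eqP => //= ->.
  by rewrite (negPf re) scaleN1r.
have -> : -1 = (-1)^-1 :> K by rewrite invrN invr1.
by rewrite {2}invrN invr1; apply: RowScale; rewrite oppr_eq0 oner_eq0.
Qed.

Lemma ops_add_rows n (A : 'M_n) s (a : 'I_n -> R) :
  a s = 0 -> (forall i, S (a i)) ->
  ops A 1 (\matrix_(i, j) (A i j + a i * A s j)).
Proof.
move=> as0 Sa.
suff H (e : seq 'I_n) : uniq e -> s \notin e ->
    ops A 1 (\matrix_(i, j) (if i \in e then A i j + a i * A s j else A i j)).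
  have := H (enum (predC1 s)) (enum_uniq _); rewrite mem_enum /= inE eqxx => /(_ isT).
  congr ops; apply/matrixP=> i j; rewrite !mxE mem_enum inE /=.
  by case: eqP => //= ->; rewrite as0 mul0r addr0.
elim: e => [|r e IH] /=.
  move=> _ _; set B := \matrix_(_, _) _.
  suff -> : B = A by exact: OpsRefl.
  by apply/matrixP=> i j; rewrite mxE.
case/andP=> re ue; rewrite inE negb_or => /andP[sr se].
rewrite -[1]mulr1; apply: (ops_trans (IH ue se)).
apply: row_op_ops; set B := \matrix_(_, _) _; set C := \matrix_(_, _) _.
have -> : C = \matrix_(i, j) (if i == r then B i j + a r * B s j else B i j).
  apply/matrixP=> i j; rewrite !mxE inE; case: eqP => //= ->.
  by rewrite (negPf re) (negPf se).
by apply: RowAdd => //; rewrite eq_sym.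
Qed.

Lemma ops_neg_cols n (A : 'M_n) (U : pred 'I_n) :
  ops A ((-1) ^+ #|U|) (\matrix_(i, j) (if U j then - A i j else A i j)).
Proof.
have /ops_tr := ops_neg_rows A^T U; rewrite trmxK.
by congr ops; apply/matrixP=> i j; rewrite !mxE.
Qed.

Lemma ops_add_cols n (A : 'M_n) s (a : 'I_n -> R) :
  a s = 0 -> (forall i, S (a i)) ->
  ops A 1 (\matrix_(i, j) (A i j + a j * A i s)).
Proof.
move=> as0 Sa; have /ops_tr := ops_add_rows A^T as0 Sa; rewrite trmxK.
by congr ops; apply/matrixP=> i j; rewrite !mxE.
Qed.
End ElementaryOperationsTheory.

(** * Matrices with labelled rows and columns *)

(** The number of inversions with respect to decreasing order, the order in which
    the strips are listed. *)
Fixpoint ascents (s : seq int) : nat :=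
  if s is x :: s' then (count (fun y => (x < y)%R) s' + ascents s')%N else 0%N.

(** Moving [x] to the front of [s1] passes [size s1] other labels, and each pass
    creates or destroys exactly one ascent. *)
Lemma odd_ascents_move (s1 s2 : seq int) x : x \notin s1 ->
  odd (ascents (s1 ++ x :: s2)) = odd (ascents (x :: s1 ++ s2)) (+) odd (size s1).
Proof.
elim: s1 => [|y s1 IH] /=; first by rewrite addbF.
rewrite inE negb_or => /andP[xy /IH /= {}IH].
have [xy' yx'] : (x < y) = ~~ (y < x) /\ (y < x) = ~~ (x < y) by case: ltgtP xy.
rewrite !oddD IH !count_cat /= !oddD xy'.
rewrite oddb; move: (odd (count (fun z => y < z) s1)) (odd (count (fun z => x < z) s1)).
move: (odd (count (fun z => y < z) s2)) (odd (count (fun z => x < z) s2)).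
move: (odd (ascents _)) (odd (size s1)) => b1 b2 b3 b4 b5 b6.
by case: (y < x); move: b1 b2 b3 b4 b5 b6; do 6 case.
Qed.

(** Strips enter a determinant only through their starting and ending contents,
    so a matrix is described by the lists of these: permuting the strips permutes
    the labels, and the entries remain functions of the labels. *)
Definition labelled_mx (R : Type) n (f : int -> int -> R) (rs cs : seq int) : 'M[R]_n :=
  \matrix_(i, j) f (nth 0 cs j) (nth 0 rs i).

Section LabelledMatrices.
Variables (K : fieldType) (R : comAlgType K) (S : R -> Prop).
Implicit Types (f : int -> int -> R) (rs cs : seq int).

Lemma labelled_mx_tr n f rs cs :
  (labelled_mx n f rs cs)^T = labelled_mx n (fun p q => f q p) cs rs.
Proof. by apply/matrixP=> i j; rewrite !mxE. Qed.

Lemma ops_swap_cols n f rs t x y s : size (t ++ x :: y :: s) = n ->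
  ops S (labelled_mx n f rs (t ++ x :: y :: s)) (-1)
        (labelled_mx n f rs (t ++ y :: x :: s)).
Proof.
rewrite size_cat /= => sz.
have lt1 : (size t < n)%N by lia.
have lt2 : ((size t).+1 < n)%N by lia.
rewrite -[-1]mulr1; apply: OpsCol (OpsRefl _ _).
rewrite !labelled_mx_tr; set A := labelled_mx _ _ _ _; set B := labelled_mx _ _ _ _.
have -> : B = xrow (Ordinal lt1) (Ordinal lt2) A.
  apply/matrixP=> i j; rewrite !mxE; congr f.
  case: tpermP => [->|->|/eqP/negPf ni1 /eqP/negPf ni2] /=.
  - by rewrite !nth_cat /= ltnn ltnNge leqnSn /= subnn subSnn.
  - by rewrite !nth_cat /= ltnn ltnNge leqnSn /= subnn subSnn.
  rewrite !nth_cat; case: ltnP => // le.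
  case E: (i - size t)%N => [|[|m]] //=.
  - by move/negP: ni1; case; apply/eqP/val_inj=> /=; lia.
  - by move/negP: ni2; case; apply/eqP/val_inj=> /=; lia.
by apply: RowSwap; apply/eqP=> /(congr1 val) /= ; lia.
Qed.

Lemma ops_move_col n f rs t s1 x s2 : size (t ++ s1 ++ x :: s2) = n ->
  ops S (labelled_mx n f rs (t ++ s1 ++ x :: s2)) ((-1) ^+ size s1)
        (labelled_mx n f rs (t ++ x :: s1 ++ s2)).
Proof.
elim: s1 t => [|y s1 IH] t sz /=; first exact: OpsRefl.
rewrite exprSr; apply: (@ops_trans _ _ _ _ _ (labelled_mx n f rs (t ++ y :: x :: s1 ++ s2))).
  by have := IH (rcons t y); rewrite !cat_rcons; apply.
by apply: ops_swap_cols; move: sz; rewrite !size_cat /= !size_cat /=; lia.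
Qed.

(** Selection sort: the first label of [cs'] is moved to the front, at the price of
    as many signs as labels are passed, and the prefix [t] collects the columns
    that are already in place. *)
Lemma ops_perm_cols n f rs t cs cs' :
  perm_eq cs cs' -> uniq cs -> size (t ++ cs) = n ->
  ops S (labelled_mx n f rs (t ++ cs)) ((-1) ^+ (ascents cs + ascents cs'))
        (labelled_mx n f rs (t ++ cs')).
Proof.
elim: cs' t cs => [|x cs' IH] t cs pcs.
  move/perm_nilP: pcs => -> _ _; rewrite expr0; exact: OpsRefl.
have xcs : x \in cs by rewrite (perm_mem pcs) mem_head.
case/splitPr: xcs pcs => s1 s2 pcs; rewrite cat_uniq => /and3P[u1 h u2] sz.
have xs1 : x \notin s1 by move: h; rewrite /= negb_or => /andP[].
have pcs' : perm_eq (s1 ++ s2) cs'.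
  by move: pcs; rewrite (perm_catCA s1 [:: x] s2) /= perm_cons.
have u' : uniq (s1 ++ s2).
  rewrite cat_uniq u1; move: h u2 => /=; rewrite negb_or => /andP[_ ->] /andP[_ ->].
  by [].
have -> : (-1) ^+ (ascents (s1 ++ x :: s2) + ascents (x :: cs')) =
    (-1) ^+ size s1 * (-1) ^+ (ascents (s1 ++ s2) + ascents cs') :> K.
  rewrite -exprD -signr_odd -[RHS]signr_odd; congr (_ ^+ (nat_of_bool _)).
  rewrite !oddD odd_ascents_move //= !oddD (seq.permP pcs').
  move: (odd (count _ _)) (odd (ascents _)) (odd (ascents _)) (odd (size _)).
  by do 4 case.
apply: ops_trans (ops_move_col _ _ sz) _.
rewrite -!cat_rcons; apply: IH => //.
by move: sz; rewrite !size_cat /= size_rcons; lia.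
Qed.

Lemma ops_perm n f rs rs' cs cs' :
  perm_eq rs rs' -> uniq rs -> size rs = n ->
  perm_eq cs cs' -> uniq cs -> size cs = n ->
  ops S (labelled_mx n f rs cs) ((-1) ^+ (ascents rs + ascents rs' + (ascents cs + ascents cs')))
        (labelled_mx n f rs' cs').
Proof.
move=> prs urs srs pcs ucs scs; rewrite exprD.
apply: ops_trans (ops_perm_cols (t := [::]) _ _ pcs ucs scs).
have /ops_tr := ops_perm_cols (t := [::]) (fun p q => f q p) cs prs urs srs.
by rewrite !labelled_mx_tr.
Qed.

Lemma card_label_pred n (s : seq int) (P : pred int) : size s = n ->
  #|[pred i : 'I_n | P (nth 0 s i)]| = count P s.
Proof.
by move=> sz; rewrite -sum1_card -sum1_count (big_nth 0) sz big_mkord.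
Qed.
End LabelledMatrices.

(** * The matrix operations behind a twist *)

Section Twist.
Variables (K : fieldType) (R : comAlgType K) (S : R -> Prop).
Variables (f f' : int -> int -> R) (lo hi i : int).
Hypotheses (lo_i : lo <= i) (i_hi : i < hi).
Hypothesis f'_low : forall p q : int, lo <= p -> q <= i -> f' p q = f p q.
Hypothesis f'_high : forall p q : int, i + 1 <= p -> q <= hi -> f' p q = f p q.
Hypothesis f_split : forall p q : int, lo <= p <= i -> i < q <= hi ->
  f p i * f (i + 1) q = f p q + f' p q.
Hypothesis f_empty : f (i + 1) i = 1.
Hypothesis f_undef : forall p q : int, q + 1 < p -> f p q = 0.
Hypothesis S_f : forall p q : int, lo <= p -> q <= hi -> S (f p q).

Let S0 : S 0.
Proof.
by have <- : f (i + 2) i = 0; [apply: f_undef; lia | apply: S_f; lia].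
Qed.

Variables (n : nat) (rs cs : seq int).
Hypotheses (size_rs : size rs = n) (size_cs : size cs = n).
Hypotheses (rs_hi : {in rs, forall q, q <= hi}) (cs_lo : {in cs, forall p, lo <= p}).

Let row_hi (r : 'I_n) : nth 0 rs r <= hi.
Proof. by apply: rs_hi; rewrite mem_nth ?size_rs. Qed.
Let col_lo (c : 'I_n) : lo <= nth 0 cs c.
Proof. by apply: cs_lo; rewrite mem_nth ?size_cs. Qed.

(** The row ending at [i] has entries [f p i], zero beyond the column [i + 1].
    Adding its multiple by [f (i + 1) q] to the negated row [q > i] produces
    [f' p q] in the columns [p <= i]; in the columns [p > i + 1] only the sign is
    wrong. *)
Lemma twist_at_end : uniq rs -> i \in rs -> i + 1 \notin cs ->
  ops S (labelled_mx n f rs cs)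
    ((-1) ^+ (count (fun q => i < q) rs + count (fun p => i + 1 < p) cs))
    (labelled_mx n f' rs cs).
Proof.
move=> urs irs ics; set A := labelled_mx _ _ _ _.
have ltk : (index i rs < n)%N by rewrite -size_rs index_mem.
pose k := Ordinal ltk.
have kE (r : 'I_n) : (nth 0 rs r == i) = (r == k).
  apply/eqP/eqP=> [e|->]; last by rewrite nth_index.
  by apply: val_inj; rewrite /= -e index_uniq ?size_rs.
pose a (r : 'I_n) := if i < nth 0 rs r then f (i + 1) (nth 0 rs r) else 0.
rewrite exprD -(card_label_pred _ size_rs) -(card_label_pred _ size_cs).
apply: (ops_trans (ops_neg_rows S A _)).
rewrite -[X in ops _ _ X _]mul1r; apply: (ops_trans (ops_add_rows (s := k) (a := a) _ _ _)).
- by rewrite /a nth_index // ltxx.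
- by move=> r; rewrite /a; case: ifP => // _; apply: S_f => //; lia.
set B := labelled_mx _ _ _ _; set A2 := (X in ops _ X _ _).
have := ops_neg_cols S A2 [pred c : 'I_n | i + 1 < nth 0 cs c].
congr ops; apply/matrixP=> r c; rewrite !mxE /= /a.
have hp := col_lo c; have hq := row_hi r.
have pc : nth 0 cs c != i + 1.
  by apply: contraNneq ics => <-; rewrite mem_nth ?size_cs.
rewrite nth_index // ltxx; move: hp hq pc.
set p := nth 0 cs c; set q := nth 0 rs r => hp hq pc.
have [qi|qi] := ltP i q; last first.
  rewrite mul0r addr0; case: ifP => [h|_]; last by rewrite f'_low.
  by rewrite f'_low // f_undef ?oppr0 //; lia.
case: ifP => h.
  have z : f p i = 0 by apply: f_undef; lia.
  by rewrite f'_high ?z ?mulr0 ?addr0 ?opprK //; lia.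
by rewrite mulrC f_split ?addKr //; lia.
Qed.

(** The transposed computation: the column starting at [i + 1] has entries
    [f (i + 1) q], zero for [q < i], and is added to the negated columns
    [p <= i]. *)
Lemma twist_at_start : uniq cs -> i + 1 \in cs -> i \notin rs ->
  ops S (labelled_mx n f rs cs)
    ((-1) ^+ (count (fun q => q < i) rs + count (fun p => p <= i) cs))
    (labelled_mx n f' rs cs).
Proof.
move=> ucs ics irs; set A := labelled_mx _ _ _ _.
have ltk : (index (i + 1)%R cs < n)%N by rewrite -size_cs index_mem.
pose k := Ordinal ltk.
pose a (c : 'I_n) := if nth 0 cs c <= i then f (nth 0 cs c) i else 0.
rewrite addnC exprD -(card_label_pred _ size_rs) -(card_label_pred _ size_cs).
apply: (ops_trans (ops_neg_cols S A _)).
rewrite -[X in ops _ _ X _]mul1r; apply: (ops_trans (ops_add_cols (s := k) (a := a) _ _ _)).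
- by rewrite /a nth_index //; case: ifP => //; lia.
- by move=> r; rewrite /a; case: ifP => // _; apply: S_f => //; lia.
set B := labelled_mx _ _ _ _; set A2 := (X in ops _ X _ _).
have := ops_neg_rows S A2 [pred r : 'I_n | nth 0 rs r < i].
congr ops; apply/matrixP=> r c; rewrite !mxE /= /a.
have hp := col_lo c; have hq := row_hi r.
have qi : nth 0 rs r != i.
  by apply: contraNneq irs => <-; rewrite mem_nth ?size_rs.
rewrite nth_index //; move: hp hq qi.
set p := nth 0 cs c; set q := nth 0 rs r => hp hq qi.
have -> : (i + 1 <= i) = false by lia.
have [pi|pi] := leP p i; last first.
  rewrite mul0r addr0; case: ifP => [h|_]; last by rewrite f'_high //; lia.
  by rewrite f'_low ?f_undef ?oppr0 //; lia.
case: ifP => h.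
  have z : f (i + 1) q = 0 by apply: f_undef; lia.
  by rewrite f'_low ?z ?mulr0 ?addr0 ?opprK //; lia.
by rewrite f_split ?addKr //; lia.
Qed.

(** Here no line is available for the additions.  An identity block serves as a
    new row [i] and column [i + 1], which meet in [f' (i + 1) i = 1].  Once the other
    rows and columns have been negated as before, adding the new row to the others
    fills the new column, and adding this column to the others fills the new row
    and corrects the entries with [p <= i < q]. *)
Lemma twist_new : i \notin rs -> i + 1 \notin cs ->
  reachable S (1, [:: mx (labelled_mx n f rs cs)])
    ((-1) ^+ (count (fun q => i < q) rs + count (fun p => i + 1 < p) cs),
     [:: mx (labelled_mx n.+1 f' (i :: rs) (i + 1 :: cs))]).
Proof.
move=> irs ics; set A := labelled_mx n _ _ _.
set sg := (-1) ^+ _.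
pose A1 : 'M[R]_n := \matrix_(r, c) (if i < nth 0 rs r then - A r c else A r c).
pose A2 : 'M[R]_n := \matrix_(r, c) (if i + 1 < nth 0 cs c then - A1 r c else A1 r c).
have h2 : ops S A sg A2.
  rewrite /sg exprD -(card_label_pred _ size_rs) -(card_label_pred _ size_cs).
  by apply: (ops_trans (ops_neg_rows S A _)); exact: ops_neg_cols.
apply: reachable_trans (ops_reachable 1 [::] [::] h2) _; rewrite mul1r /=.
apply: reachable_trans (rt_step _ _ _ _ (StepInsert1 S sg [::] _ 1)) _ => /=.
apply: reachable_trans (rt_step _ _ _ _ (StepJoin S sg [::] [::] _ _)) _ => /=.
set B := block_mx _ _ _ _; rewrite -[X in (X, [:: mx (labelled_mx _ _ _ _)])]mulr1.
apply: (ops_reachable sg [::] [::]).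
pose a (r : 'I_(1 + n)) : R :=
  if split r is inr r' then f (i + 1) (nth 0 rs r') else 0.
pose b (c : 'I_(1 + n)) : R :=
  if split c is inr c' then f (nth 0 cs c') i else 0.
have Sa r : S (a r) by rewrite /a; case: split => // r'; apply: S_f => //; lia.
have Sb c : S (b c) by rewrite /b; case: split => // r'; apply: S_f => //; lia.
pose o : 'I_(1 + n) := lshift n ord0.
have aL x : a (lshift n x) = 0 by rewrite /a (unsplitK (inl x)).
have aR x : a (rshift 1 x) = f (i + 1) (nth 0 rs x) by rewrite /a (unsplitK (inr x)).
have bL x : b (lshift n x) = 0 by rewrite /b (unsplitK (inl x)).
have bR x : b (rshift 1 x) = f (nth 0 cs x) i by rewrite /b (unsplitK (inr x)).
rewrite -[X in ops _ _ X _]mul1r.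
apply: (ops_trans (ops_add_rows (s := o) B (aL _) Sa)).
set B1 := (X in ops _ X _ _).
have B1E r c : B1 r c = B r c + a r * B o c by rewrite mxE.
have := ops_add_cols (s := o) B1 (bL _) Sb.
congr ops; apply/matrixP=> r c; rewrite [LHS]mxE [RHS]mxE !B1E.
case: (@splitP 1 n r) => r' rE; case: (@splitP 1 n c) => c' cE;
  rewrite [in RHS]rE [in RHS]cE.
- have -> : r = lshift n r' by exact: val_inj.
  have -> : c = lshift n c' by exact: val_inj.
  rewrite aL bL !mul0r !addr0 block_mxEul !ord1 mxE eqxx /=.
  have -> : f' (i + 1) i = f (i + 1) i by apply: f'_low; lia.
  by rewrite f_empty.
- have -> : r = lshift n r' by exact: val_inj.
  have -> : c = rshift 1 c' by exact: val_inj.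
  rewrite aL bR !mul0r !addr0 block_mxEur block_mxEul !ord1 !mxE eqxx mulr1 add0r.
  by rewrite add1n /= f'_low.
- have -> : r = rshift 1 r' by exact: val_inj.
  have -> : c = lshift n c' by exact: val_inj.
  rewrite aR bL !mul0r !addr0 block_mxEdl block_mxEul !ord1 !mxE eqxx mulr1 add0r.
  by rewrite add1n /= f'_high.
have -> : r = rshift 1 r' by exact: val_inj.
have -> : c = rshift 1 c' by exact: val_inj.
rewrite aR bR block_mxEdr block_mxEur block_mxEdl block_mxEul !mxE eqxx !add1n /=.
have hp := col_lo c'; have hq := row_hi r'.
have qi : nth 0 rs r' != i.
  by apply: contraNneq irs => <-; rewrite mem_nth ?size_rs.
have pc : nth 0 cs c' != i + 1.
  by apply: contraNneq ics => <-; rewrite mem_nth ?size_cs.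
move: hp hq qi pc; set p := nth 0 cs c'; set q := nth 0 rs r' => hp hq qi pc.
rewrite mulr0 addr0 add0r mulr1.
have [pi|pi] := leP p i.
  have -> : (i + 1 < p) = false by lia.
  have [iq|iq] := ltP i q; first by rewrite f_split ?addKr //; lia.
  have -> : f (i + 1) q = 0 by apply: f_undef; lia.
  by rewrite mulr0 addr0 f'_low.
have -> : (i + 1 < p) by lia.
have -> : f p i = 0 by apply: f_undef; lia.
rewrite mul0r addr0 f'_high //; last by lia.
have [iq|iq] := ltP i q; first by rewrite opprK.
by have -> : f p q = 0; [apply: f_undef; lia | rewrite oppr0].
Qed.
End Twist.

(** * Ribbon Schur functions *)

Definition dir_ok (u : bool) (x y : nat) : bool := if u then (y < x)%N else (x <= y)%N.

(** The fillings of the strip with directions [ups] whose first box contains [x].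
    Recursion on the first box makes cutting a strip into two a formal
    manipulation of sums. *)
Fixpoint ribbon_from (n : nat) (ups : seq bool) (x : 'I_n) : {mpoly rat[n]} :=
  if ups is u :: ups' then 'X_x * \sum_(y < n | dir_ok u x y) ribbon_from ups' y
  else 'X_x.

Definition ribbon (ups : seq bool) : varpoly := fun n => \sum_(x < n) ribbon_from ups x.

Lemma ribbon_from_split n u1 u2 (x : 'I_n) :
  ribbon_from u1 x * ribbon u2 n =
  ribbon_from (u1 ++ true :: u2) x + ribbon_from (u1 ++ false :: u2) x.
Proof.
elim: u1 x => [|u u1 IH] x /=.
  rewrite -mulrDr; congr (_ * _).
  rewrite /ribbon (bigID (fun y : 'I_n => dir_ok true x y)) /=; congr (_ + _).
  by apply: eq_bigl => y; rewrite -leqNgt.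
rewrite -mulrA -mulrDr; congr (_ * _); rewrite mulr_suml -big_split /=.
by apply: eq_bigr => y _; exact: IH.
Qed.

(** A pair of fillings of two strips, placed one after the other, has either
    [x > y] or [x <= y] for the last entry [x] of the first and the first entry [y]
    of the second: it fills the strip obtained by joining them upwards or
    rightwards, and not both. *)
Lemma ribbon_split u1 u2 :
  ribbon u1 * ribbon u2 = ribbon (u1 ++ true :: u2) + ribbon (u1 ++ false :: u2).
Proof.
apply: functional_extensionality_dep => n.
rewrite [LHS]mulr_suml [RHS]/(GRing.add _ _) /=.
rewrite -[RHS]/(ribbon _ n + ribbon _ n) -big_split /=.
by apply: eq_bigr => x _; exact: ribbon_from_split.
Qed.

Fixpoint walk_ok (ups : seq bool) (w : seq nat) : bool :=
  match ups, w with
  | u :: ups', x :: ((y :: _) as w') => dir_ok u x y && walk_ok ups' w'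
  | _, _ => true
  end.

Lemma big_tuple_cons (V : nmodType) (I : finType) k (P : pred (k.+1.-tuple I))
    (G : k.+1.-tuple I -> V) :
  \sum_(w : k.+1.-tuple I | P w) G w =
  \sum_(x : I) \sum_(v : k.-tuple I | P [tuple of x :: v]) G [tuple of x :: v].
Proof.
rewrite pair_big_dep /= (reindex (fun xv : I * k.-tuple I => [tuple of xv.1 :: xv.2])) //=.
exists (fun w => (thead w, [tuple of behead w])).
- by move=> [x v] _ /=; congr pair; apply: val_inj.
- by move=> w _; rewrite [RHS]tuple_eta.
Qed.

Lemma ribbon_fromE n ups (x : 'I_n) :
  ribbon_from ups x =
  \sum_(v : (size ups).-tuple 'I_n | walk_ok ups (map val (x :: v)))
    \prod_(y <- x :: v) 'X_y.
Proof.
elim: ups x => [|u ups IH] x /=.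
  rewrite (big_pred1 [tuple]) /= ?big_seq1 // => v.
  by apply/esym/eqP; exact: tuple0.
rewrite big_tuple_cons mulr_sumr big_mkcond /=; apply: eq_bigr => y _.
case: ifP => _; last by rewrite big_pred0.
rewrite IH mulr_sumr; apply: eq_bigr => v _.
by rewrite [RHS]big_cons.
Qed.

Lemma ribbonE n ups :
  ribbon ups n =
  \sum_(w : (size ups).+1.-tuple 'I_n | walk_ok ups (map val w)) \prod_(y <- w) 'X_y.
Proof. by rewrite big_tuple_cons; apply: eq_bigr => x _; rewrite ribbon_fromE. Qed.

Lemma walk_ok_column k (w : seq nat) : size w = k.+1 ->
  walk_ok (nseq k true) w = sorted gtn w.
Proof.
case: w => [//|x w] [<-] {k} /=.
by elim: w x => //= y w IH x; rewrite IH.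
Qed.

(** A column filling is a strictly decreasing word, that is, a set. *)
Lemma ribbon_column k n : ribbon (nseq k true) n = mesym n rat k.+1.
Proof.
rewrite ribbonE mesym_tupleE size_nseq.
rewrite (reindex (fun w : k.+1.-tuple 'I_n => [tuple of rev w])) /=; last first.
  by exists (fun w : k.+1.-tuple 'I_n => [tuple of rev w]) => w _; apply: val_inj; rewrite /= revK.
apply: eq_big => [w|w _]; last by rewrite big_rev.
by rewrite walk_ok_column ?size_map ?size_rev ?size_tuple // map_rev rev_sorted.
Qed.

(** Induction on the number of steps to the right, using [ribbon_split] to turn one
    of them into a step up; what remains are columns.  Columns rather than rows
    serve as the base case because the symmetry of the elementary polynomials is a
    standard fact. *)
Lemma ribbon_symmetric ups n : ribbon ups n \is symmetric.
Proof.
have [m] := ubnP (count negb ups); elim: m ups => // m IH ups.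
(* [false] is a step to the right. *)
have [/splitPr[u1 u2] | ups1 _] := boolP (false \in ups).
  rewrite count_cat /= => lt_m.
  have := congr1 (fun f : varpoly => f n) (ribbon_split u1 u2).
  move/(canLR (addKr _)) => <-; rewrite rpredD ?rpredN ?rpredM ?IH //.
  - by rewrite count_cat /=; lia.
  - by lia.
  - by lia.
have -> : ups = nseq (size ups) true.
  by apply/all_pred1P/allP => -[] // /(negP ups1).
by rewrite ribbon_column mesym_sym.
Qed.

Lemma drop_last_var_X n (x : 'I_n.+1) :
  drop_last_var 'X_x = if unlift ord_max x is Some y then 'X_y else 0.
Proof. by rewrite /drop_last_var comp_mpolyXU -tnth_nth tnth_mktuple. Qed.

Lemma drop_last_var_sum n (I : finType) (P : pred I) (G : I -> {mpoly rat[n.+1]}) :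
  drop_last_var (\sum_(i | P i) G i) = \sum_(i | P i) drop_last_var (G i).
Proof. exact: raddf_sum. Qed.

(** Fillings using the variable set to zero disappear, the others are the fillings
    in fewer variables. *)
Lemma drop_last_var_from n ups (x : 'I_n.+1) :
  drop_last_var (ribbon_from ups x) =
  if unlift ord_max x is Some y then ribbon_from ups y else 0.
Proof.
elim: ups x => [|u ups IH] x /=; first exact: drop_last_var_X.
rewrite /drop_last_var rmorphM /= -!/(drop_last_var _) drop_last_var_X drop_last_var_sum.
case: unliftP => [y ->|->]; last by rewrite mul0r.
congr (_ * _); rewrite big_mkcond (bigD1_ord ord_max) //= IH unlift_none.
rewrite if_same add0r [RHS]big_mkcond; apply: eq_bigr => z _.
have bumpE (t : 'I_n) : bump n t = t by rewrite /bump leqNgt ltn_ord.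
by rewrite IH liftK !bumpE.
Qed.

Lemma msize_ribbon_from n ups (x : 'I_n) :
  (msize (ribbon_from ups x) <= 3 * size ups + 2)%N.
Proof.
elim: ups x => [|u ups IH] x /=; first by rewrite msizeX mdeg1.
apply: leq_trans (msizeM_le _ _) _; rewrite msizeX mdeg1 mulnS -addnA !addSn add0n !ltnS.
by apply: leq_trans (msize_sum _ _ _) _; apply/bigmax_leqP => y _; exact: IH.
Qed.

Lemma ribbon_symmetric_function ups : is_symmetric_function (ribbon ups).
Proof.
split=> [n | n | ]; first exact: ribbon_symmetric.
- rewrite /ribbon drop_last_var_sum (bigD1_ord ord_max) //=.
  rewrite [X in X + _]drop_last_var_from unlift_none add0r.
  by apply: eq_bigr => y _; rewrite [LHS]drop_last_var_from liftK.
- exists (3 * size ups + 2)%N => n; apply: leq_trans (msize_sum _ _ _) _.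
  by apply/bigmax_leqP => y _; exact: msize_ribbon_from.
Qed.

Lemma symmetric_function0 : is_symmetric_function 0.
Proof.
split=> [n|n|]; first exact: rpred0.
- by rewrite /drop_last_var raddf0.
- by exists 0%N => n; rewrite msize0.
Qed.

Lemma symmetric_function1 : is_symmetric_function 1.
Proof.
split=> [n|n|]; first exact: rpred1.
- by rewrite /drop_last_var rmorph1.
- by exists 1%N => n; rewrite msize1.
Qed.

Lemma symmetric_functionN f : is_symmetric_function f -> is_symmetric_function (- f).
Proof.
case=> f_sym f_drop [d f_deg]; split=> [n|n|].
- by rewrite -[(- f) n]/(- f n) rpredN; exact: f_sym.
- by rewrite -[RHS]/(- f n) -f_drop; exact: raddfN.
- by exists d => n; rewrite -[(- f) n]/(- f n) msizeN.
Qed.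

(** * Strips and their tableaux *)

Definition step (b : box) (u : bool) : box := if u then up_of b else right_of b.

Definition walk (b : box) (ups : seq bool) (t : nat) : box := foldl step b (take t ups).

Definition ribbon_boxes (b : box) (ups : seq bool) : {fset box} :=
  [fset x in b :: scanl step b ups]%fset.

Lemma strip_alongE c ups : strip_along c ups = ribbon_boxes (0, c) ups.
Proof. by []. Qed.

Lemma ribbon_boxesP b ups x :
  reflect (exists2 t, (t <= size ups)%N & x = walk b ups t) (x \in ribbon_boxes b ups).
Proof.
rewrite !inE -[_ || _]/(x \in b :: scanl step b ups).
have nthE t : (t <= size ups)%N -> nth b (b :: scanl step b ups) t = walk b ups t.
  by case: t => [|t] le_t /=; [rewrite /walk take0 | rewrite nth_scanl].
apply: (iffP (nthP b)) => [[t] | [t le_t ->]]; rewrite /= size_scanl.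
- by rewrite ltnS => le_t <-; exists t => //; rewrite nthE.
- by exists t; rewrite ?nthE //= size_scanl ltnS.
Qed.

Lemma walkS b ups t : (t < size ups)%N ->
  walk b ups t.+1 = step (walk b ups t) (nth false ups t).
Proof. by move=> lt_t; rewrite /walk (take_nth false) // -cats1 foldl_cat. Qed.

Lemma content_step b u : content (step b u) = content b + 1.
Proof. by case: u; rewrite /content /=; ring. Qed.

Lemma content_walk b ups t : (t <= size ups)%N -> content (walk b ups t) = content b + t%:Z.
Proof.
elim: t => [|t IH] lt_t; first by rewrite /walk take0 addr0.
by rewrite walkS // content_step IH ?(ltnW lt_t) //; lia.
Qed.

Lemma walk_row b ups s t : (s <= t <= size ups)%N -> (walk b ups t).1 <= (walk b ups s).1.
Proof.
case/andP; elim: t => [|t IH]; first by rewrite leqn0 => /eqP->.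
rewrite leq_eqVlt => /predU1P[-> //|le_s] lt_t; rewrite walkS //.
by apply: le_trans (IH le_s (ltnW lt_t)); case: nth => //=; lia.
Qed.

Lemma walk_col b ups s t : (s <= t <= size ups)%N -> (walk b ups s).2 <= (walk b ups t).2.
Proof.
case/andP; elim: t => [|t IH]; first by rewrite leqn0 => /eqP->.
rewrite leq_eqVlt => /predU1P[-> //|le_s] lt_t; rewrite walkS //.
by apply: le_trans (IH le_s (ltnW lt_t)) _; case: nth => //=; lia.
Qed.

Lemma walk_okP ups (w : seq nat) : size w = (size ups).+1 ->
  reflect (forall t, (t < size ups)%N -> dir_ok (nth false ups t) (nth 0%N w t) (nth 0%N w t.+1))
    (walk_ok ups w).
Proof.
elim: ups w => [|u ups IH] [|x w] //= [sz]; first by left.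
case: w sz => [//|y w] sz.
apply: (iffP andP) => [[ok1 /(IH (y :: w) sz) ok2] [|t] // lt_t | ok].
  exact: ok2.
split; first exact: (ok 0%N).
by apply/(IH (y :: w) sz) => t lt_t; exact: (ok t.+1).
Qed.

(** A walk never goes down or left, so two boxes in one row are joined by steps to
    the right only, and two boxes in one column by steps up only; the conditions on
    consecutive boxes then chain together. *)
Lemma walk_mono (b : box) (ups : seq bool) (w : seq nat) :
  size w = (size ups).+1 -> walk_ok ups w ->
  forall s t, (s < t <= size ups)%N ->
    ((walk b ups s).1 = (walk b ups t).1 -> (nth 0%N w s <= nth 0%N w t)%N) /\
    ((walk b ups s).2 = (walk b ups t).2 -> (nth 0%N w t < nth 0%N w s)%N).
Proof.
move=> sz /(walk_okP sz) ok s; elim=> [//|t IH] /andP[]; rewrite ltnS leq_eqVlt.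
case/predU1P=> [-> | lt_s] lt_t.
  have := ok _ lt_t; rewrite walkS //; case: nth => /= h; split=> //.
  - by lia.
  - by lia.
have [|IH1 IH2] := IH; first by rewrite lt_s ltnW.
have r1 : (walk b ups t).1 <= (walk b ups s).1 by apply: walk_row; lia.
have r2 : (walk b ups s).2 <= (walk b ups t).2 by apply: walk_col; lia.
have := ok _ lt_t; rewrite walkS //; case: nth => /= h; split=> h'.
- by lia.
- by apply: ltn_trans h (IH2 h').
- by apply: leq_trans (IH1 h') h.
- by lia.
Qed.

(** Numbering the boxes by content turns tableaux into words, and [walk_mono]
    reduces semistandardness to consecutive boxes. *)
Lemma skew_schur_ribbon b ups : skew_schur (ribbon_boxes b ups) = ribbon ups.
Proof.
apply: functional_extensionality_dep => n; rewrite ribbonE /skew_schur.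
set E := ribbon_boxes b ups; set k := size ups.
have walk_in (t : 'I_k.+1) : walk b ups t \in E.
  by apply/ribbon_boxesP; exists t => //; rewrite -ltnS.
pose pt t : E := [` walk_in t]%fset.
pose ix (e : E) : 'I_k.+1 := inord `|content (val e) - content b|%N.
have ptK : cancel pt ix.
  move=> t; apply: val_inj; rewrite /ix.
  have -> : `|content (val (pt t)) - content b|%N = t.
    by rewrite /= content_walk; have := ltn_ord t; lia.
  by rewrite /= inordK.
have ixK : cancel ix pt.
  move=> e; apply: val_inj => /=.
  have [t le_t te] := ribbon_boxesP _ _ _ (valP e).
  have -> : ix e = t :> nat.
    rewrite /ix te content_walk //.
    have -> : `|(content b + t%:Z)%R - content b|%N = t by lia.
    by rewrite inordK.
  exact: esym te.
pose T_of (w : k.+1.-tuple 'I_n) := [ffun e : E => tnth w (ix e)].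
rewrite (reindex T_of) /=; last first.
  exists (fun T : {ffun E -> 'I_n} => [tuple T (pt t) | t < k.+1]).
  - by move=> w _; apply: eq_from_tnth => t; rewrite tnth_mktuple ffunE ptK.
  - by move=> T _; apply/ffunP=> e; rewrite ffunE tnth_mktuple ixK.
apply: eq_big => [w | w _]; last first.
  rewrite big_tuple (reindex pt) /=; last by exists ix => ? _; [exact: ptK | exact: ixK].
  by apply: eq_bigr => t _; rewrite ffunE ptK.
have sz : size (map val w) = (size ups).+1 by rewrite size_map size_tuple.
have nthE (t : 'I_k.+1) : nth 0%N (map val w) t = T_of w (pt t).
  rewrite ffunE ptK (nth_map (tnth w t)) ?size_tuple ?ltn_ord //.
  by rewrite -tnth_nth.
apply/idP/idP => [ss | ok].
  apply/(walk_okP sz) => t lt_t.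
  have lt1 : (t < k.+1)%N by rewrite ltnS ltnW.
  have lt2 : (t.+1 < k.+1)%N by rewrite ltnS.
  rewrite -[t]/(val (Ordinal lt1)) nthE -[(val _).+1]/(val (Ordinal lt2)) nthE.
  have h := walkS b lt_t; rewrite /dir_ok.
  case: ifP => up; rewrite up /= in h.
    have /forallP/(_ (pt (Ordinal lt2)))/forallP/(_ (pt (Ordinal lt1)))/andP[_ /implyP] := ss.
    by apply; rewrite /= h /= eqxx /=; lia.
  have /forallP/(_ (pt (Ordinal lt1)))/forallP/(_ (pt (Ordinal lt2)))/andP[/implyP + _] := ss.
  by apply; rewrite /= h /= eqxx /=; lia.
have mono := walk_mono b sz ok.
apply/forallP=> e; apply/forallP=> e'; rewrite -(ixK e) -(ixK e') /= -!nthE.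
move: (ix e) (ix e') => s t; apply/andP; split; apply/implyP=> /andP[/eqP h1 h2].
  have lt : (s < t)%N.
    rewrite ltnNge; apply/negP=> le.
    have : (walk b ups s).1 <= (walk b ups t).1 by apply: walk_row; rewrite le -ltnS ltn_ord.
    have := walk_col b (ups := ups) (s := t) (t := s); rewrite le -ltnS ltn_ord => /(_ isT).
    by lia.
  by apply: (mono s t _).1 => //; rewrite lt -ltnS ltn_ord.
have lt : (t < s)%N.
  rewrite ltnNge; apply/negP=> le.
  have := walk_row b (ups := ups) (s := s) (t := t); rewrite le -ltnS ltn_ord => /(_ isT).
  by lia.
by apply: (mono t s _).2 => //; rewrite lt -ltnS ltn_ord.
Qed.

(** * Segments of the cutting strip *)

Lemma schur_fset0 : skew_schur fset0 = 1.
Proof.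
apply: functional_extensionality_dep => n; rewrite /skew_schur.
have e0 (e : fset0 : {fset box}) : False by case: e => x; rewrite inE.
pose T0 : {ffun (fset0 : {fset box}) -> 'I_n} := [ffun e => False_rect _ (e0 e)].
rewrite (big_pred1 T0) => [|T]; first by rewrite big1 // => e; case: (e0 e).
have -> : T = T0 by apply/ffunP=> e; case: (e0 e).
by rewrite [RHS](introT eqP erefl); apply/forallP=> e; case: (e0 e).
Qed.

Definition schur_entry (c : int) (ups : seq bool) (p q : int) : varpoly :=
  schur_option (segment (strip_along c ups) p q).

Lemma walk_drop b ups s t : (s + t <= size ups)%N ->
  walk (walk b ups s) (drop s ups) t = walk b ups (s + t).
Proof. by move=> le; rewrite /walk -foldl_cat takeD. Qed.

Lemma walk_take b ups s t : (t <= s)%N -> walk b (take s ups) t = walk b ups t.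
Proof. by move=> le; rewrite /walk take_takel. Qed.

Lemma schur_entry_ribbon c ups p q :
  c <= p -> p <= q -> q <= c + (size ups)%:Z ->
  schur_entry c ups p q = ribbon (take `|q - p|%N (drop `|p - c|%N ups)).
Proof.
move=> cp pq qn; rewrite /schur_entry /segment pq /=.
rewrite -(skew_schur_ribbon (walk (0, c) ups `|p - c|%N)); congr skew_schur.
have phiP := @ribbon_boxesP (0, c) ups; rewrite -strip_alongE in phiP.
move: (strip_along c ups) phiP => phi phiP.
apply/fsetP=> x; rewrite [LHS]inE [LHS]/=.
set s := `|p - c|%N; set m := `|q - p|%N.
have sz : size (take m (drop s ups)) = m by rewrite size_takel // size_drop; lia.
have walkE t : (t <= m)%N ->
    walk (walk (0, c) ups s) (take m (drop s ups)) t = walk (0, c) ups (s + t).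
  by move=> le; rewrite walk_take // walk_drop //; lia.
have c0 : content (0, c) = c by rewrite /content /=; lia.
rewrite [LHS]inE; apply/andP/ribbon_boxesP => [[/phiP[t le_t ->]] | [t]].
  rewrite content_walk // c0 => h; exists (t - s)%N; first by rewrite sz; lia.
  by rewrite walkE; [congr walk; lia | lia].
rewrite sz => le_t ->; rewrite walkE // content_walk ?c0; last by lia.
by split; [apply/phiP; exists (s + t)%N => //; lia | lia].
Qed.

Lemma schur_entry_empty c ups p : schur_entry c ups (p + 1) p = 1.
Proof.
rewrite /schur_entry /segment eqxx.
have -> : (p + 1 <= p) = false by lia.
exact: schur_fset0.
Qed.

Lemma schur_entry_undef c ups p q : q + 1 < p -> schur_entry c ups p q = 0.
Proof.
move=> h; rewrite /schur_entry /segment.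
have -> : (p <= q) = false by lia.
by have -> : (p == q + 1) = false by lia.
Qed.

Lemma schur_entry_symmetric c ups p q :
  c <= p -> q <= c + (size ups)%:Z -> is_symmetric_function (schur_entry c ups p q).
Proof.
move=> cp qn; have [pq|pq] := leP p q.
  by rewrite schur_entry_ribbon //; exact: ribbon_symmetric_function.
have [->|pq'] := eqVneq p (q + 1).
  by rewrite schur_entry_empty; exact: symmetric_function1.
by rewrite schur_entry_undef; [exact: symmetric_function0 | lia].
Qed.

(** The effect on the segments of changing the single direction that follows
    [u1]. *)
Section Flip.
Variables (c : int) (u1 u2 : seq bool) (b b' : bool).
Let ups := u1 ++ b :: u2.
Let ups' := u1 ++ b' :: u2.
Let i : int := c + (size u1)%:Z.
Let hi : int := c + (size ups)%:Z.

Let size_ups' : size ups' = size ups.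
Proof. by rewrite !size_cat. Qed.

Lemma schur_entry_low p q : c <= p -> q <= i -> schur_entry c ups' p q = schur_entry c ups p q.
Proof.
move=> cp qi; have [pq|pq] := leP p q.
  rewrite !schur_entry_ribbon ?size_ups' //; try by rewrite size_cat /=; lia.
  congr ribbon; rewrite !drop_cat; case: ltnP => h; last first.
    have -> : `|q - p|%N = 0%N by lia.
    by rewrite !take0.
  by rewrite !takel_cat ?size_drop //; lia.
have [->|pq'] := eqVneq p (q + 1); first by rewrite !schur_entry_empty.
by rewrite !schur_entry_undef //; lia.
Qed.

Lemma schur_entry_high p q : i + 1 <= p -> q <= hi ->
  schur_entry c ups' p q = schur_entry c ups p q.
Proof.
move=> cp qi; have [pq|pq] := leP p q.
  rewrite !schur_entry_ribbon ?size_ups' //; try by lia.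
  congr ribbon; rewrite !drop_cat; case: ltnP => h; first by lia.
  by case E: (_ - _)%N => [|m] //; lia.
have [->|pq'] := eqVneq p (q + 1); first by rewrite !schur_entry_empty.
by rewrite !schur_entry_undef //; lia.
Qed.

Lemma schur_entry_split p q : b' = ~~ b -> c <= p <= i -> i < q <= hi ->
  schur_entry c ups p i * schur_entry c ups (i + 1) q =
  schur_entry c ups p q + schur_entry c ups' p q.
Proof.
move=> b'E /andP[cp pi] /andP[iq qh].
have sz : (size ups = size u1 + (size u2).+1)%N by rewrite size_cat.
rewrite !schur_entry_ribbon ?size_ups' //; try by lia.
set v1 := drop `|p - c|%N u1; set v2 := take `|q - (i + 1)%R|%N u2.
have dropE x : drop `|p - c|%N (u1 ++ x) = v1 ++ x.
  rewrite drop_cat; case: ltnP => h //; rewrite /v1 (drop_oversize h).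
  have -> : (`|p - c|%N - size u1)%N = 0%N by lia.
  by rewrite drop0.
rewrite /ups /ups' !dropE -/ups.
have szv : size v1 = `|i - p|%N by rewrite size_drop; lia.
rewrite (takel_cat _ (eq_leq _)) // -{1}szv take_size.
have -> : drop `|(i + 1)%R - c|%N ups = u2.
  have -> : `|(i + 1)%R - c|%N = (size u1).+1 by lia.
  by rewrite /ups -cat_rcons drop_size_cat // size_rcons.
have takeE x : take `|q - p|%N (v1 ++ x :: u2) = v1 ++ x :: v2.
  rewrite take_cat szv; have -> : (`|q - p| < `|i - p|)%N = false by lia.
  by have -> : (`|q - p| - `|i - p|)%N = (`|q - (i + 1)%R|).+1 by lia.
rewrite /ups /ups' !takeE b'E ribbon_split; case: b => //; exact: addrC.
Qed.
End Flip.

(** * Convex and connected diagrams *)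

(** The form in which the shape of a skew diagram is used: neighbours of two given
    boxes are found in the diagram because they lie in the rectangle spanned by the
    two boxes. *)
Definition convex (D : {fset box}) : Prop := forall a b x : box, a \in D -> b \in D ->
  a.1 <= x.1 <= b.1 -> a.2 <= x.2 <= b.2 -> x \in D.

Lemma in_skew_shape k (lam mu : k.-tuple nat) x :
  reflect (exists r : 'I_k, exists2 c : nat, (tnth mu r < c <= tnth lam r)%N &
      x = ((r : nat).+1%:Z, c%:Z))
    (x \in skew_shape lam mu).
Proof.
rewrite inE; apply: (iffP flatten_mapP) => [[r _ /mapP[c]] | [r [c h ->]]].
  by rewrite mem_iota => h ->; exists r; exists c => //; lia.
exists r; first by rewrite mem_enum.
by apply/mapP; exists c => //; rewrite mem_iota; lia.
Qed.

Lemma sorted_geq_tnth k (s : k.-tuple nat) : sorted geq s ->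
  forall r r' : 'I_k, (r <= r')%N -> (tnth s r' <= tnth s r)%N.
Proof.
move=> s_sorted r r' le; rewrite !(tnth_nth 0%N).
have geq_trans : transitive geq by move=> x y z /= h1 h2; exact: leq_trans h2 h1.
apply: (sorted_leq_nth geq_trans _ _ s_sorted) => //.
- by move=> x /=.
- by rewrite inE size_tuple.
- by rewrite inE size_tuple.
Qed.

Lemma skew_shape_convex k (lam mu : k.-tuple nat) :
  partition_pair lam mu -> convex (skew_shape lam mu).
Proof.
case=> lam_sorted mu_sorted _ a b [xr xc].
case/in_skew_shape=> r [c h ->] /in_skew_shape[r' [c' h' ->]] /= hr hc.
have ltk : (`|xr|.-1 < k)%N by have := ltn_ord r'; lia.
apply/in_skew_shape; exists (Ordinal ltk); exists `|xc|%N; last by congr pair => /=; lia.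
have := sorted_geq_tnth mu_sorted (r := r) (r' := Ordinal ltk).
have := sorted_geq_tnth lam_sorted (r := Ordinal ltk) (r' := r').
by rewrite /=; lia.
Qed.

Lemma skew_diagram_convex D : is_skew_diagram D -> convex D.
Proof.
case=> k [lam [mu [v [/skew_shape_convex conv ->]]]] a b x.
case/imfsetP=> a' /= aD -> /imfsetP[b' /= bD ->] /= h1 h2.
apply/imfsetP; exists (x.1 - v.1, x.2 - v.2) => /=.
  by apply: conv aD bD _ _ => /=; lia.
by case: x {h1 h2} => x1 x2 /=; congr pair; lia.
Qed.

(** Adjacent boxes have contents differing by one.  If no box had content [c], the
    boxes of smaller content would be closed under adjacency. *)
Lemma connected_contents E a b c : edgewise_connected E -> a \in E -> b \in E ->
  content a <= c <= content b -> exists2 x, x \in E & content x = c.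
Proof.
case/andP=> _ /forallP conn aE bE /andP[ac cb].
have [/existsP[x /eqP xc] | no] := boolP [exists x : E, content (val x) == c].
  by exists (val x) => //; exact: valP.
have {}no (x : E) : content (val x) != c.
  by apply: contra no => h; apply/existsP; exists x.
pose A := [pred x : E | content (val x) < c].
have clA : closed (fun x y : E => share_edge (val x) (val y)) A.
  move=> x y; rewrite !inE => xy; have := no x; have := no y; move: xy.
  by rewrite /share_edge !inE /content => /or4P[] /eqP -> /=; lia.
have := closed_connect clA (forallP (conn [` aE]%fset) [` bE]%fset).
have := no [` aE]%fset; rewrite !inE /=; lia.
Qed.

Lemma mem_diagonals D c : reflect (exists2 x, x \in D & content x = c) (c \in diagonals D).
Proof.
rewrite mem_sort mem_undup; apply: (iffP mapP) => -[x xD h]; by exists x.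
Qed.

Lemma diagonals_bounds D x : x \in D -> start_content D <= content x <= end_content D.
Proof.
move=> xD; have /(nthP 0)[t lt_t <-] : content x \in diagonals D.
  by apply/mem_diagonals; exists x.
have srt : sorted <=%R (diagonals D) by apply: sort_sorted; exact: le_total.
have mono := sorted_leq_nth le_trans lexx 0 srt.
rewrite /start_content /end_content -nth0 -nth_last.
apply/andP; split; apply: mono; rewrite ?inE; case: (diagonals D) lt_t => //= *; lia.
Qed.

Lemma start_end_mem D : D != fset0 ->
  (exists2 x, x \in D & content x = start_content D) /\
  (exists2 x, x \in D & content x = end_content D).
Proof.
case/fset0Pn=> x xD; have dx : content x \in diagonals D.
  by apply/mem_diagonals; exists x.
rewrite /start_content /end_content.
have dP := @mem_diagonals D; case: (diagonals D) dx dP => // c s _ dP.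
by split; apply/dP; [rewrite mem_head | rewrite /= mem_last].
Qed.

Lemma connected_contentsP E c : edgewise_connected E ->
  reflect (exists2 x, x \in E & content x = c) (start_content E <= c <= end_content E).
Proof.
move=> conn; apply: (iffP idP) => [h | [x xE <-]]; last exact: diagonals_bounds.
have /start_end_mem[[a aE ca] [b bE cb]] : E != fset0 by case/andP: conn.
by apply: connected_contents conn aE bE _; rewrite ca cb.
Qed.

Lemma diagonals_connected E : edgewise_connected E ->
  diagonals E = mkseq (fun t => start_content E + t%:Z)
    `|end_content E - start_content E|.+1.
Proof.
move=> conn; apply: (irr_sorted_eq lt_trans ltxx).
- by rewrite sort_lt_sorted undup_uniq.
- apply/(sortedP 0); rewrite size_mkseq => t lt_t.
  by rewrite !nth_mkseq //; lia.
have /start_end_mem[[a aE ca] [b bE cb]] : E != fset0 by case/andP: conn.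
have := diagonals_bounds aE; rewrite ca => le_se.
move=> c; apply/mem_diagonals/mapP => [/(connected_contentsP c conn) h | [t]].
  by exists `|c - start_content E|%N; [rewrite mem_iota; lia | lia].
by rewrite mem_iota => ht ->; apply/(connected_contentsP _ conn); lia.
Qed.

(** The box of a walk with a given content is unique, so the set of boxes determines
    every box of the walk, hence every direction. *)
Lemma strip_along_inj c ups ups' : size ups = size ups' ->
  strip_along c ups = strip_along c ups' -> ups = ups'.
Proof.
move=> sz eq; have walkE t : (t <= size ups)%N -> walk (0, c) ups t = walk (0, c) ups' t.
  move=> le_t; have : walk (0, c) ups t \in strip_along c ups'.
    by rewrite -eq; apply/ribbon_boxesP; exists t.
  case/ribbon_boxesP=> t' le_t' wE.
  have := congr1 content wE; rewrite !content_walk // => /addrI [tt'].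
  by rewrite wE tt'.
apply: (eq_from_nth (x0 := false)) => // t lt_t.
have := walkE t.+1 lt_t; rewrite !walkS -?sz // walkE ?(ltnW lt_t) //.
by case: (nth _ ups); case: (nth _ ups') => // -[]; lia.
Qed.

(** * Rows of a diagonal *)

Definition diagonal_rows (D : {fset box}) (c : int) : seq int :=
  sort >=%R [seq x.1 | x <- D & content x == c].

Definition height D c : nat := size (diagonal_rows D c).
Definition bottom D c : int := head 0 (diagonal_rows D c).

Lemma seq_int_bounds (s : seq int) : s != [::] ->
  exists mn mx, [/\ mn \in s, mx \in s & {in s, forall x, mn <= x <= mx}].
Proof.
elim: s => // x s IH _; have [-> | /IH [mn [mx [mns mxs h]]]] := eqVneq s [::].
  by exists x, x; rewrite mem_head; split=> // y; rewrite inE => /eqP->; rewrite lexx.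
exists (Num.min x mn), (Num.max x mx); split.
- by rewrite inE /Order.min; case: ifP; rewrite ?eqxx // mns orbT.
- by rewrite inE /Order.max; case: ifP; rewrite ?eqxx // mxs orbT.
- by move=> y; rewrite inE => /predU1P[->|/h]; lia.
Qed.

Section Diagonal.
Variable D : {fset box}.
Implicit Types c r s : int.
Hypotheses (D_convex : convex D) (D_conn : edgewise_connected D).
Local Notation lo := (start_content D).
Local Notation hi := (end_content D).

Lemma mem_diagonal_rows c r : (r \in diagonal_rows D c) = ((r, r + c) \in D).
Proof.
rewrite mem_sort; apply/mapP/idP => [[[x1 x2]] | rD].
  by rewrite mem_filter /content /= => /andP[/eqP <- xD] ->; have -> : x1 + (x2 - x1) = x2 by lia.
by exists (r, r + c) => //; rewrite mem_filter rD andbT /content /=; apply/eqP; lia.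
Qed.

(** By convexity the rows of a diagonal form an interval. *)
Lemma diagonal_rowsE c : lo <= c <= hi ->
  (0 < height D c)%N /\
  diagonal_rows D c = mkseq (fun t => bottom D c - t%:Z) (height D c).
Proof.
case/(connected_contentsP c D_conn)=> x xD xc.
have xr : x.1 \in diagonal_rows D c.
  by rewrite mem_diagonal_rows -xc /content addrC subrK -surjective_pairing.
have [] := @seq_int_bounds (diagonal_rows D c); first by case: (diagonal_rows D c) xr.
move=> mn [mx [mnD mxD bnd]].
have mn_mx : mn <= mx by have := bnd _ mnD; lia.
suff E : diagonal_rows D c = mkseq (fun t => mx - t%:Z) `|mx - mn|.+1.
  have szE : height D c = `|mx - mn|.+1 by rewrite /height E size_mkseq.
  by rewrite szE; split=> //; rewrite E /bottom E /= subr0.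
apply: (sorted_eq (leT := >=%R)).
- by move=> a b d /= h1 h2; exact: le_trans h2 h1.
- by move=> a b /=; rewrite andbC; exact: le_anti.
- by apply: sort_sorted => a b; exact: le_total.
- by apply/(sortedP 0); rewrite size_mkseq => t lt_t; rewrite !nth_mkseq //; lia.
apply: uniq_perm.
- rewrite sort_uniq map_inj_in_uniq ?filter_uniq ?fset_uniq //.
  move=> [a1 a2] [b1 b2]; rewrite !mem_filter /content /= => /andP[/eqP ha _] /andP[/eqP hb _] e.
  by congr pair => //; lia.
- by rewrite mkseq_uniq // => a b; lia.
move=> r; apply/idP/mapP => [/bnd h | [t]].
  by exists `|mx - r|%N; [rewrite mem_iota; lia | lia].
rewrite mem_iota mem_diagonal_rows => ht ->; rewrite !mem_diagonal_rows in mnD mxD.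
by apply: (D_convex mnD mxD) => /=; lia.
Qed.

Lemma mem_diagonal c r : lo <= c <= hi ->
  ((r, r + c) \in D) = (bottom D c - (height D c)%:Z < r <= bottom D c).
Proof.
move=> hc; have [ht0 E] := diagonal_rowsE hc.
rewrite -mem_diagonal_rows E; apply/mapP/idP => [[t] | h].
  by rewrite mem_iota => ht ->; lia.
by exists `|bottom D c - r|%N; [rewrite mem_iota; lia | lia].
Qed.

(** From the diagonal [c] to the diagonal [c + 1] the bottom row stays or moves up by
    one, and so does the top row, here compared through the empty row above it
    ([consecutive_diagonals]). *)
Definition bottom_kept c : bool := bottom D (c + 1) == bottom D c.
Definition top_raised c : bool :=
  bottom D (c + 1) - (height D (c + 1))%:Z < bottom D c - (height D c)%:Z.

(** A box of content [c] weakly above a box of content [c + 1] forces the right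
    neighbour of the first and the left neighbour of the second into the diagram,
    and in the other case it is an upper and a lower neighbour.  Applied to the two
    top boxes and to the two bottom boxes this leaves two possibilities for each. *)
Lemma consecutive_diagonals c : lo <= c -> c < hi ->
  bottom D (c + 1) = bottom D c - (~~ bottom_kept c)%:Z /\
  bottom D (c + 1) - (height D (c + 1))%:Z = bottom D c - (height D c)%:Z - (top_raised c)%:Z.
Proof.
move=> lc ch; have h1 : lo <= c <= hi by lia.
have h2 : lo <= c + 1 <= hi by lia.
have [p1 _] := diagonal_rowsE h1; have [p2 _] := diagonal_rowsE h2.
have adj r s : (r, r + c) \in D -> (s, s + (c + 1)) \in D ->
    if r <= s then ((r, r + (c + 1)) \in D) && ((s, s + c) \in D)
    else ((r - 1, r - 1 + (c + 1)) \in D) && ((s + 1, s + 1 + c) \in D).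
  move=> rD sD; case: ifP => rs; apply/andP; split.
  - by apply: (D_convex rD sD) => /=; lia.
  - by apply: (D_convex rD sD) => /=; lia.
  - by apply: (D_convex sD rD) => /=; lia.
  - by apply: (D_convex sD rD) => /=; lia.
rewrite /bottom_kept /top_raised.
set b := bottom D c in p1 *; set b' := bottom D (c + 1) in p2 *.
set h := height D c in p1 *; set h' := height D (c + 1) in p2 *.
have adj' r s : b - h%:Z < r <= b -> b' - h'%:Z < s <= b' ->
    if r <= s then (b' - h'%:Z < r <= b') && (b - h%:Z < s <= b)
    else (b' - h'%:Z < r - 1 <= b') && (b - h%:Z < s + 1 <= b).
  by have := adj r s; rewrite !mem_diagonal.
have := adj' b b'; have := adj' (b - h%:Z + 1) (b' - h'%:Z + 1).
do 2 case: ifP => ?; move=> A1 A2; split; lia.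
Qed.

Lemma height_succ c : lo <= c -> c < hi ->
  (height D (c + 1) + 1 = height D c + bottom_kept c + top_raised c)%N.
Proof.
move=> lc ch; have [] := consecutive_diagonals lc ch; lia.
Qed.

(** Two boxes on the first diagonal would span a rectangle with a box of smaller
    content. *)
Lemma height_lo : height D lo = 1%N.
Proof.
have h : lo <= lo <= hi.
  have /start_end_mem[[a aE ca] [b bE cb]] : D != fset0 by case/andP: D_conn.
  by have := diagonals_bounds aE; rewrite ca.
have [p _] := diagonal_rowsE h; apply/eqP; rewrite eqn_leq p andbT leqNgt; apply/negP=> p2.
have m1 : (bottom D lo, bottom D lo + lo) \in D by rewrite mem_diagonal //; lia.
have m2 : (bottom D lo - 1, bottom D lo - 1 + lo) \in D by rewrite mem_diagonal //; lia.
have m3 : (bottom D lo, bottom D lo - 1 + lo) \in D by apply: (D_convex m2 m1) => /=; lia.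
by have := diagonals_bounds m3; rewrite /content /=; lia.
Qed.

Lemma height_hi : height D hi = 1%N.
Proof.
have h : lo <= hi <= hi.
  have /start_end_mem[[a aE ca] [b bE cb]] : D != fset0 by case/andP: D_conn.
  by have := diagonals_bounds bE; rewrite cb.
have [p _] := diagonal_rowsE h; apply/eqP; rewrite eqn_leq p andbT leqNgt; apply/negP=> p2.
have m1 : (bottom D hi, bottom D hi + hi) \in D by rewrite mem_diagonal //; lia.
have m2 : (bottom D hi - 1, bottom D hi - 1 + hi) \in D by rewrite mem_diagonal //; lia.
have m3 : (bottom D hi - 1, bottom D hi + hi) \in D by apply: (D_convex m2 m1) => /=; lia.
by have := diagonals_bounds m3; rewrite /content /=; lia.
Qed.
End Diagonal.

(** * Strips of an outside decomposition *)

Lemma filter_lt_succ (T : eqType) (e : T -> int) (s : seq T) (c : int) :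
  sorted (fun x y => e y < e x) s ->
  [seq x <- s | e x < c + 1] = [seq x <- s | e x == c] ++ [seq x <- s | e x < c].
Proof.
elim: s => //= x s IH xs; have e_trans : transitive (fun x y => e y < e x).
  by move=> y1 y2 y3 h1 h2; exact: lt_trans h2 h1.
have /allP lt_x : all (fun y => e y < e x) s by exact: order_path_min xs.
have {}IH := IH (path_sorted xs).
case: (ltgtP (e x) c) => xc.
- have -> : (e x < c + 1) = true by lia.
  rewrite IH; have -> : [seq y <- s | e y == c] = [::]; last by [].
  apply/eqP; rewrite -[_ == _]negbK -has_filter -all_predC.
  by apply/allP => y /lt_x /= ; lia.
- have -> : (e x < c + 1) = false by lia.
  exact: IH.
have -> : (e x < c + 1) = true by lia.
by rewrite IH.
Qed.

Lemma filter_eq_uniq (T : eqType) (a : pred T) (s : seq T) x :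
  uniq s -> x \in s -> a x -> {in s, forall y, a y -> y = x} -> [seq y <- s | a y] = [:: x].
Proof.
move=> us xs ax h; rewrite -(filter_pred1_uniq us xs); apply: eq_in_filter => y ys /=.
by apply/idP/eqP => [/(h y ys) // | ->].
Qed.

Lemma box_eq (x y : box) : x.1 = y.1 -> content x = content y -> x = y.
Proof. by case: x y => [a b] [c d]; rewrite /content /= => -> ?; congr pair; lia. Qed.

Definition back (b : box) (u : bool) : box := if u then down_of b else left_of b.

Lemma backK b u : step (back b u) u = b.
Proof. by case: b u => [x y] [] /=; rewrite /up_of /right_of /=; congr pair; lia. Qed.

Lemma stepK b u : back (step b u) u = b.
Proof. by case: b u => [x y] [] /=; rewrite /down_of /left_of /=; congr pair; lia. Qed.

Lemma content_back b u : content (back b u) = content b - 1.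
Proof. by rewrite -[b in RHS](backK b u) content_step; lia. Qed.

Section StripShape.
Implicit Types x y : box.
Variable th : {fset box}.
Hypothesis strip_th : is_strip th.

(** Two boxes of one strip on the same diagonal would span a square. *)
Lemma strip_content_inj x y : x \in th -> y \in th -> content x = content y -> x = y.
Proof.
have [/skew_diagram_convex conv _ nosq] := strip_th.
wlog le : x y / x.1 <= y.1.
  move=> W; case: (leP x.1 y.1) => [/W // | lt] xth yth /esym e.
  by apply/esym; apply: W yth xth e; exact: ltW.
move=> xth yth e; have [xy | xy] := eqVneq x.1 y.1.
  exact: box_eq.
move: e; rewrite /content => e; case: nosq; exists x; rewrite xth.
by split=> //; apply: (conv _ _ _ xth yth) => /=; lia.
Qed.

Lemma strip_contentP c : reflect (exists2 x, x \in th & content x = c)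
  (start_content th <= c <= end_content th).
Proof. by apply: connected_contentsP; case: strip_th. Qed.

Lemma strip_next x y : x \in th -> y \in th -> content y = content x + 1 ->
  y = up_of x \/ y = right_of x.
Proof.
have [/skew_diagram_convex conv _ nosq] := strip_th.
move=> xth yth e; have [le | lt] := leP x.1 y.1.
  right; apply: (strip_content_inj yth); last by rewrite e /content /=; lia.
  by apply: (conv _ _ _ xth yth) => /=; move: e; rewrite /content; lia.
left; apply: (strip_content_inj yth); last by rewrite e /content /=; lia.
by apply: (conv _ _ _ yth xth) => /=; move: e; rewrite /content; lia.
Qed.
End StripShape.

Section Outside.
Implicit Types (x y : box) (c r : int).
Variables (D : {fset box}) (Pi : {fset {fset box}}).
Hypotheses (D_convex : convex D) (D_conn : edgewise_connected D).
Hypothesis Pi_outside : outside_decomposition D Pi.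
Local Notation lo := (start_content D).
Local Notation hi := (end_content D).
Local Notation dir := (diagonal_goes_up D Pi).

Lemma outside_strip th : th \in Pi -> is_strip th.
Proof. by case: Pi_outside => h _ _ _ _; exact: h. Qed.

Lemma outside_disjoint th th' x : th \in Pi -> th' \in Pi -> x \in th -> x \in th' -> th = th'.
Proof.
case: Pi_outside => _ h _ _ _ thPi thPi' xth xth'.
apply/eqP; apply: contraTT xth' => /(h _ _ thPi thPi') /fdisjointP; exact.
Qed.

Lemma outside_sub th x : th \in Pi -> x \in th -> x \in D.
Proof.
by case: Pi_outside => _ _ <- _ _ thPi xth; apply/bigfcupP; exists th; rewrite ?thPi.
Qed.

Lemma outside_cover x : x \in D -> exists2 th, th \in Pi & x \in th.
Proof.
by case: Pi_outside => _ _ <- _ _ /bigfcupP[th /andP[thPi _] xth]; exists th.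
Qed.

Lemma outside_start th x : th \in Pi -> x \in th -> content x = start_content th ->
  (left_of x \notin D) || (down_of x \notin D).
Proof. by case: Pi_outside => _ _ _ h _ thPi; exact: h thPi x. Qed.

Lemma outside_end th x : th \in Pi -> x \in th -> content x = end_content th ->
  (right_of x \notin D) || (up_of x \notin D).
Proof. by case: Pi_outside => _ _ _ _ h thPi; exact: h thPi x. Qed.

Lemma goes_upE th x : th \in Pi -> x \in th ->
  goes_up D Pi x = if content x == end_content th then up_of x \notin D else up_of x \in th.
Proof.
move=> thPi xth; apply/existsP/idP => [[th' /andP[xth'] ] | h].
  by have <- : th = val th' by apply: outside_disjoint xth xth' => //; exact: valP.
by exists [` thPi]%fset; rewrite /= xth.
Qed.

(** The nested property, for diagonally adjacent boxes [x] and [x'].  Both can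
    continue only through [y], the right neighbour of [x] and the upper neighbour
    of [x'].  As both its lower and its left neighbours are in the diagram, [y] is
    not a starting box, so its strip comes from exactly one of [x] and [x'].  If it
    comes from [x'], then [x'] goes up and [x], deprived of [y], can only go up; if
    it comes from [x], then [x] goes right and so does [x']. *)
Lemma goes_up_next x : x \in D -> right_of (down_of x) \in D ->
  goes_up D Pi (right_of (down_of x)) = goes_up D Pi x.
Proof.
set x' := right_of _ => xD xD'; pose y := right_of x.
have yE : y = up_of x' by apply: box_eq; rewrite /content /=; lia.
have yD : y \in D by apply: (D_convex xD xD') => /=; lia.
have cy : content y = content x + 1 by rewrite /content /=; lia.
have cx' : content x' = content x by rewrite /content /=; lia.
have ly : left_of y = x by apply: (stepK x false).
have dy : down_of y = x' by [].
have nxx' : x <> x' by move/(congr1 fst) => /=; lia.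
have nup : y <> up_of x by move/(congr1 fst) => /=; lia.
have rx : right_of x = y by [].
(* Only these relations between the boxes matter from here on. *)
clearbody y x'.
have [th thPi xth] := outside_cover xD; have [th' thPi' xth'] := outside_cover xD'.
have strip_t := outside_strip thPi; have strip_t' := outside_strip thPi'.
rewrite (goes_upE thPi xth) (goes_upE thPi' xth') -yE cx' yD /=.
have [th2 thPi2 yth2] := outside_cover yD; have strip_t2 := outside_strip thPi2.
have [start_y y_end] := andP (introT (strip_contentP strip_t2 _) (ex_intro2 _ _ y yth2 erefl)).
have not_start : content y != start_content th2.
  by apply/eqP=> /(outside_start thPi2 yth2); rewrite ly dy xD xD'.
have [z zth2 cz] : exists2 z, z \in th2 & content z = content x.
  by apply/(strip_contentP strip_t2); move: start_y y_end not_start; rewrite cy; clear; lia.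
have cx_end : content x != end_content th2 by move: y_end; rewrite cy; clear; lia.
have [yz | yz] := strip_next strip_t2 zth2 yth2 (etrans cy (congr1 (+%R^~ 1) (esym cz))).
  have zx' : z = x' by apply: (can_inj (stepK^~ true)); rewrite /= -yz -yE.
  have e : th' = th2 by apply: (outside_disjoint thPi' thPi2 xth'); rewrite -zx'.
  rewrite e (negPf cx_end) yth2; case: eqP => [ce | ce].
    by have := outside_end thPi xth ce; rewrite rx yD /= => ->.
  have [w wth cw] : exists2 w, w \in th & content w = content x + 1.
    have := introT (strip_contentP strip_t _) (ex_intro2 _ _ x xth erefl).
    by move=> h; apply/(strip_contentP strip_t); move: h ce; clear; lia.
  have [<- | wE] := strip_next strip_t xth wth cw; first by rewrite wth.
  have e2 : th = th2.
    by apply: (outside_disjoint thPi thPi2 _ yth2); rewrite -rx -wE.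
  have xth2 : x \in th2 by rewrite -e2.
  have xth2' : x' \in th2 by rewrite -e.
  by case: nxx'; exact: (strip_content_inj strip_t2 xth2 xth2' (esym cx')).
have zx : z = x by apply: (can_inj (stepK^~ false)); rewrite /= -yz rx.
have e : th = th2 by apply: (outside_disjoint thPi thPi2 xth); rewrite -zx.
rewrite e (negPf cx_end).
have -> : (up_of x \in th2) = false.
  apply/negP=> h; apply: nup; apply: (strip_content_inj strip_t2 yth2 h).
  by rewrite cy -[up_of x]/(step x true) content_step.
case: ifP => // _; apply/negP=> yth'.
have e' : th' = th2 by apply: (outside_disjoint thPi' thPi2 yth' yth2).
have xth2 : x \in th2 by rewrite -e.
have xth2' : x' \in th2 by rewrite -e'.
by case: nxx'; exact: (strip_content_inj strip_t2 xth2 xth2' (esym cx')).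
Qed.

Lemma goes_up_content x y : x \in D -> y \in D -> content x = content y ->
  goes_up D Pi x = goes_up D Pi y.
Proof.
wlog le : x y / x.1 <= y.1.
  move=> W; case: (leP x.1 y.1) => [/W // | lt] xD yD /esym e.
  by apply/esym; apply: W yD xD e; exact: ltW.
move=> xD yD e.
pose at_ (t : nat) : box := (x.1 + t%:Z, x.2 + t%:Z).
have yE : y = at_ `|y.1 - x.1|%N.
  by move: e; rewrite /content => e; apply: box_eq; rewrite /content /=; lia.
rewrite yE.
have : (`|y.1 - x.1| <= `|y.1 - x.1|)%N by [].
move: {1 3}(`|y.1 - x.1|)%N => t; elim: t => [|t IH] le_t.
  by congr goes_up; rewrite [LHS]surjective_pairing /at_ !addr0.
have inD s : (s <= `|y.1 - x.1|)%N -> at_ s \in D.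
  by move=> le_s; apply: (D_convex xD yD) => /=; move: e; rewrite /content; lia.
rewrite IH; last by lia.
have E : at_ t.+1 = right_of (down_of (at_ t)) by rewrite /right_of /=; congr pair; lia.
by rewrite E goes_up_next // -?E; apply: inD; lia.
Qed.

Lemma dirE x : x \in D -> dir (content x) = goes_up D Pi x.
Proof.
move=> xD; apply/existsP/idP => [[y /andP[/eqP e]] | h].
  by rewrite (goes_up_content (valP y) xD e).
by exists [` xD]%fset; rewrite /= eqxx.
Qed.

Lemma step_in th x : th \in Pi -> x \in th -> step x (dir (content x)) \in D ->
  step x (dir (content x)) \in th /\ content x < end_content th.
Proof.
move=> thPi xth; have xD := outside_sub thPi xth; have strip_t := outside_strip thPi.
have bnd := introT (strip_contentP strip_t _) (ex_intro2 _ _ x xth erefl).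
rewrite dirE // (goes_upE thPi xth); case: (eqVneq (content x) (end_content th)) => [ce | ce].
  have := outside_end thPi xth ce.
  by case: (boolP (up_of x \in D)) => [u | u] /=; rewrite ?orbF ?(negPf u) // => /negPf ->.
move=> _; split; last by lia.
have [w wth cw] : exists2 w, w \in th & content w = content x + 1.
  by apply/(strip_contentP strip_t); lia.
have [//|nup] := boolP (up_of x \in th).
have [wE | wE] := strip_next strip_t xth wth cw; last by rewrite /= -wE.
by rewrite -wE wth in nup.
Qed.

(** A strip is followed along the direction of the diagonal as long as this stays
    inside the diagram. *)
Lemma is_end th x : th \in Pi -> x \in th ->
  (content x == end_content th) = (step x (dir (content x)) \notin D).
Proof.
move=> thPi xth; have xD := outside_sub thPi xth; have strip_t := outside_strip thPi.
have bnd := introT (strip_contentP strip_t _) (ex_intro2 _ _ x xth erefl).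
have [h | /negP h] := boolP (step x _ \in D); first by have [_] := step_in thPi xth h; lia.
apply/eqP; case: (eqVneq (content x) (end_content th)) => // ce; case: h.
have [w wth cw] : exists2 w, w \in th & content w = content x + 1.
  by apply/(strip_contentP strip_t); lia.
rewrite dirE // (goes_upE thPi xth) (negPf ce).
have wD := outside_sub thPi wth.
have [wE | wE] := strip_next strip_t xth wth cw; first by rewrite -wE wth /= -wE.
by have [/(outside_sub thPi) | _] := boolP (up_of x \in th); rewrite //= -wE.
Qed.

Lemma is_start th x : th \in Pi -> x \in th ->
  (content x == start_content th) = (back x (dir (content x - 1)) \notin D).
Proof.
move=> thPi xth; have xD := outside_sub thPi xth; have strip_t := outside_strip thPi.
have bnd := introT (strip_contentP strip_t _) (ex_intro2 _ _ x xth erefl).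
set u := dir _; have cb : content (back x u) = content x - 1 := content_back _ _.
have [h | h] := boolP (back x u \in D).
  have [th' thPi' bth'] := outside_cover h.
  have [] := step_in thPi' bth'; rewrite cb -/u backK // => xth' lt.
  have e : th = th' by apply: outside_disjoint xth xth'.
  have := introT (strip_contentP strip_t _) (ex_intro2 _ _ (back x u) _ erefl).
  by rewrite e bth' => /(_ isT); rewrite cb; lia.
apply/eqP; case: (eqVneq (content x) (start_content th)) => // ce; case/negP: h.
have [w wth cw] : exists2 w, w \in th & content w = content x - 1.
  by apply/(strip_contentP strip_t); lia.
have wD := outside_sub thPi wth.
have := is_end thPi wth; rewrite cw -/u => /esym.
have -> : (content x - 1 == end_content th) = false by lia.
move/negbFE => sD; have sD' : step w (dir (content w)) \in D by rewrite cw.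
have [sth _] := step_in thPi wth sD'; rewrite cw -/u in sth.
have -> : x = step w u.
  by apply: (strip_content_inj strip_t xth sth); rewrite content_step cw; lia.
by rewrite stepK.
Qed.

(** The default is never reached on boxes of the diagram. *)
Definition strip_start (x : box) : int :=
  start_content (head fset0 [seq th <- Pi | x \in (th : {fset box})]).

Lemma strip_startE th x : th \in Pi -> x \in th -> strip_start x = start_content th.
Proof.
move=> thPi xth; congr start_content.
have : th \in [seq th <- Pi | x \in (th : {fset box})] by rewrite mem_filter xth.
case E: [seq _ <- _ | _] => [//|th' s] _ /=.
have : th' \in [seq th <- Pi | x \in (th : {fset box})] by rewrite E mem_head.
by rewrite mem_filter => /andP[xth' thPi']; exact: outside_disjoint xth' xth.
Qed.

Lemma strip_start_step x : x \in D -> step x (dir (content x)) \in D ->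
  strip_start (step x (dir (content x))) = strip_start x.
Proof.
move=> xD sD; have [th thPi xth] := outside_cover xD.
by have [sth _] := step_in thPi xth sD; rewrite (strip_startE thPi xth) (strip_startE thPi sth).
Qed.

Lemma strip_start_new x : x \in D -> back x (dir (content x - 1)) \notin D ->
  strip_start x = content x.
Proof.
move=> xD bD; have [th thPi xth] := outside_cover xD.
by rewrite (strip_startE thPi xth); apply/esym/eqP; rewrite (is_start thPi xth).
Qed.

Lemma strip_bounds th : th \in Pi ->
  [/\ lo <= start_content th, start_content th <= end_content th & end_content th <= hi].
Proof.
move=> thPi; have strip_t := outside_strip thPi.
have /start_end_mem[[a ath ca] [b bth cb]] : th != fset0 by case: strip_t => _ /andP[].
have := diagonals_bounds ath; rewrite ca => /andP[_ ->].
have := diagonals_bounds (outside_sub thPi ath); rewrite ca => /andP[-> _].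
by have := diagonals_bounds (outside_sub thPi bth); rewrite cb => /andP[_ ->].
Qed.

Lemma start_box th : th \in Pi -> exists2 x, x \in th & content x = start_content th.
Proof.
move=> thPi; have := strip_bounds thPi => -[_ h _].
by apply/(strip_contentP (outside_strip thPi)); rewrite lexx.
Qed.

Lemma end_box th : th \in Pi -> exists2 x, x \in th & content x = end_content th.
Proof.
move=> thPi; have := strip_bounds thPi => -[_ h _].
by apply/(strip_contentP (outside_strip thPi)); rewrite lexx andbT.
Qed.

(** Of two boxes on a diagonal, the upper one has a right neighbour and the lower
    one an upper neighbour in the diagram. *)
Lemma loose_step_inj x y u : x \in D -> y \in D -> content x = content y ->
  step x u \notin D -> step y u \notin D -> x = y.
Proof.
wlog le : x y / x.1 <= y.1.
  move=> W; case: (leP x.1 y.1) => [/W // | lt] xD yD /esym e xs ys.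
  by apply/esym; apply: W yD xD e ys xs; exact: ltW.
move=> xD yD e xs ys; have [xy | xy] := eqVneq x.1 y.1.
  exact: box_eq.
move: e; rewrite /content => e; case: u xs ys => xs ys.
  by case/negP: ys; apply: (D_convex xD yD) => /=; lia.
by case/negP: xs; apply: (D_convex xD yD) => /=; lia.
Qed.

Lemma loose_back_inj x y u : x \in D -> y \in D -> content x = content y ->
  back x u \notin D -> back y u \notin D -> x = y.
Proof.
wlog le : x y / x.1 <= y.1.
  move=> W; case: (leP x.1 y.1) => [/W // | lt] xD yD /esym e xs ys.
  by apply/esym; apply: W yD xD e ys xs; exact: ltW.
move=> xD yD e xs ys; have [xy | xy] := eqVneq x.1 y.1.
  exact: box_eq.
move: e; rewrite /content => e; case: u xs ys => xs ys.
  by case/negP: xs; apply: (D_convex xD yD) => /=; lia.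
by case/negP: ys; apply: (D_convex xD yD) => /=; lia.
Qed.

Lemma end_content_inj : {in Pi &, injective end_content}.
Proof.
move=> th th' thPi thPi' e.
have [x xth cx] := end_box thPi; have [x' xth' cx'] := end_box thPi'.
have xD := outside_sub thPi xth; have xD' := outside_sub thPi' xth'.
have /esym := is_end thPi xth; rewrite cx eqxx => h.
have /esym := is_end thPi' xth'; rewrite cx' -e eqxx => h'.
have xx' : x = x' by apply: loose_step_inj xD xD' _ h h'; rewrite cx cx'.
by apply: outside_disjoint xth _ => //; rewrite xx'.
Qed.

Lemma start_content_inj : {in Pi &, injective start_content}.
Proof.
move=> th th' thPi thPi' e.
have [x xth cx] := start_box thPi; have [x' xth' cx'] := start_box thPi'.
have xD := outside_sub thPi xth; have xD' := outside_sub thPi' xth'.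
have /esym := is_start thPi xth; rewrite cx eqxx => h.
have /esym := is_start thPi' xth'; rewrite cx' -e eqxx => h'.
have xx' : x = x' by apply: loose_back_inj xD xD' _ h h'; rewrite cx cx'.
by apply: outside_disjoint xth _ => //; rewrite xx'.
Qed.

(** * Sweeping the diagonals *)

Lemma mem_strips th : (th \in strips Pi) = (th \in Pi).
Proof. by rewrite mem_sort. Qed.

Lemma strips_uniq : uniq (strips Pi).
Proof. by rewrite sort_uniq fset_uniq. Qed.

Lemma strips_sorted : sorted (fun th th' => end_content th' < end_content th) (strips Pi).
Proof.
have le_sorted : sorted (fun th th' => end_content th' <= end_content th) (strips Pi).
  by apply: sort_sorted => a b; exact: le_total.
apply/(sortedP fset0) => t lt_t; rewrite lt_neqAle (sortedP fset0 le_sorted) // andbT.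
have in_Pi s : (s < size (strips Pi))%N -> nth fset0 (strips Pi) s \in Pi.
  by move=> lt_s; rewrite -mem_strips mem_nth.
apply/eqP => /(end_content_inj (in_Pi _ lt_t) (in_Pi _ (ltnW lt_t)))/eqP.
by rewrite nth_uniq ?strips_uniq ?(ltnW lt_t) //; lia.
Qed.

Definition ended c : seq int :=
  [seq start_content th | th <- strips Pi & end_content th < c].

(** The starts of all strips that have begun by the diagonal [c].  The rows of a
    diagonal are listed from bottom to top; the order is chosen so that the list
    ends up as the list of starts of the strips in their own order
    ([swept_hi]). *)
Definition swept c : seq int :=
  [seq strip_start (r, r + c) | r <- diagonal_rows D c] ++ ended c.

Lemma box_content c r : content (r, r + c) = c.
Proof. by rewrite /content /= addrC addKr. Qed.

Lemma box_of_content x : x = (x.1, x.1 + content x).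
Proof. by apply: box_eq; rewrite ?box_content. Qed.

Lemma ended_loose c r : (r, r + c) \in D -> step (r, r + c) (dir c) \notin D ->
  ended (c + 1) = strip_start (r, r + c) :: ended c.
Proof.
move=> xD ends_on; have [th thPi xth] := outside_cover xD.
rewrite /ended filter_lt_succ ?strips_sorted // map_cat (strip_startE thPi xth).
have ce : end_content th = c.
  by have := is_end thPi xth; rewrite box_content ends_on => /eqP.
rewrite (filter_eq_uniq (x := th)) ?strips_uniq ?mem_strips ?ce //.
by move=> th'; rewrite mem_strips => thPi' /eqP ce'; apply: end_content_inj; rewrite ?ce.
Qed.

Lemma ended_none c :
  (forall r, (r, r + c) \in D -> step (r, r + c) (dir c) \in D) -> ended (c + 1) = ended c.
Proof.
move=> tight; rewrite /ended filter_lt_succ ?strips_sorted // map_cat.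
rewrite (_ : [seq th <- strips Pi | _ == c] = [::]) //.
apply/eqP; rewrite -[_ == _]negbK -has_filter -all_predC; apply/allP => th.
rewrite mem_strips => thPi /=; apply/eqP => ce; have [x xth cx] := end_box thPi.
have xD := outside_sub thPi xth; have := is_end thPi xth.
rewrite cx eqxx ce [x in step x _]box_of_content cx ce tight //.
by rewrite -ce -cx -box_of_content.
Qed.

Lemma strip_start_moved c r r' : (r, r + c) \in D -> (r', r' + (c + 1)) \in D ->
  r' = r - (dir c)%:Z -> strip_start (r', r' + (c + 1)) = strip_start (r, r + c).
Proof.
move=> xD x'D rr'; have sE : (r', r' + (c + 1)) = step (r, r + c) (dir c).
  by apply: box_eq; [rewrite rr'; case: (dir c) => /=; lia | rewrite content_step !box_content].
by have := strip_start_step xD; rewrite box_content -sE; apply.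
Qed.

Lemma back_box c r u : back (r, r + (c + 1)) u = (r + u%:Z, r + u%:Z + c).
Proof. by apply: box_eq; [case: u => /=; lia | rewrite content_back !box_content; lia]. Qed.

Lemma step_box c r u : step (r, r + c) u = (r - u%:Z, r - u%:Z + (c + 1)).
Proof. by apply: box_eq; [case: u => /=; lia | rewrite content_step !box_content]. Qed.

Lemma strip_start_fresh c r : (r, r + (c + 1)) \in D ->
  (r + (dir c)%:Z, r + (dir c)%:Z + c) \notin D -> strip_start (r, r + (c + 1)) = c + 1.
Proof.
move=> xD bD; have := strip_start_new xD; rewrite box_content addrK back_box; exact.
Qed.

(** Going up, the boxes shift by one row, so the bottom box of the diagonal [c + 1]
    is new exactly if the bottom row is kept, and the top box of the diagonal [c] is
    the last of its strip exactly if the top row is kept.  Going right, the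
    top box is new exactly if the top row moves up, and the bottom box ends exactly
    if the bottom row moves up. *)
Definition starts_after c : bool := if dir c then bottom_kept D c else top_raised D c.
Definition ends_on c : bool := if dir c then ~~ top_raised D c else ~~ bottom_kept D c.

Section OneStep.
Variable c : int.
Hypotheses (lo_c : lo <= c) (c_hi : c < hi).

Let b := bottom D c.
Let b' := bottom D (c + 1).
Let h := height D c.
Let h' := height D (c + 1).
Let B t := strip_start (b - t%:Z, b - t%:Z + c).
Let B' t := strip_start (b' - t%:Z, b' - t%:Z + (c + 1)).

Let in_c : lo <= c <= hi. Proof. by rewrite lo_c ltW. Qed.
Let in_c' : lo <= c + 1 <= hi. Proof. by move: lo_c c_hi; clear; lia. Qed.

Let sweptE : swept c = mkseq B h ++ ended c.
Proof. by rewrite /swept (diagonal_rowsE D_convex D_conn in_c).2 -map_comp. Qed.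

Let sweptE' : swept (c + 1) = mkseq B' h' ++ ended (c + 1).
Proof. by rewrite /swept (diagonal_rowsE D_convex D_conn in_c').2 -map_comp. Qed.

Let mem_c r : ((r, r + c) \in D) = (b - h%:Z < r <= b).
Proof. exact: mem_diagonal. Qed.

Let mem_c' r : ((r, r + (c + 1)) \in D) = (b' - h'%:Z < r <= b').
Proof. exact: mem_diagonal. Qed.

Let bE : b' = b - (~~ bottom_kept D c)%:Z.
Proof. by case: (consecutive_diagonals D_convex D_conn lo_c c_hi). Qed.

Let tE : b' - h'%:Z = b - h%:Z - (top_raised D c)%:Z.
Proof. by case: (consecutive_diagonals D_convex D_conn lo_c c_hi). Qed.

Let h_gt0 : (0 < h)%N. Proof. by case: (diagonal_rowsE D_convex D_conn in_c). Qed.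
Let h'_gt0 : (0 < h')%N. Proof. by case: (diagonal_rowsE D_convex D_conn in_c'). Qed.

Let moved t t' : (t < h)%N -> (t' < h')%N ->
  b' - t'%:Z = b - t%:Z - (dir c)%:Z -> B' t' = B t.
Proof.
move=> lt_t lt_t' e; apply: strip_start_moved => //.
- by rewrite mem_c; move: lt_t; clear; lia.
- by rewrite mem_c'; move: lt_t'; clear; lia.
Qed.

Let fresh_start t : (t < h')%N -> ~~ (b - h%:Z < b' - t%:Z + (dir c)%:Z <= b) -> B' t = c + 1.
Proof.
move=> lt_t e; apply: strip_start_fresh; last by rewrite mem_c.
by rewrite mem_c'; move: lt_t; clear; lia.
Qed.

Let loose_end t : (t < h)%N -> ~~ (b' - h'%:Z < b - t%:Z - (dir c)%:Z <= b') ->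
  ended (c + 1) = B t :: ended c.
Proof.
move=> lt_t e; apply: ended_loose; first by rewrite mem_c; move: lt_t; clear; lia.
by rewrite step_box mem_c'.
Qed.

Let no_end : (forall r, b - h%:Z < r <= b -> b' - h'%:Z < r - (dir c)%:Z <= b') ->
  ended (c + 1) = ended c.
Proof. by move=> tight; apply: ended_none => r; rewrite step_box mem_c mem_c'; exact: tight. Qed.

(** A new strip appears at the bottom, hence in front, and the top strip, which may
    end here, already stands next to the finished strips. *)
Lemma swept_up : dir c -> swept (c + 1) = if bottom_kept D c then c + 1 :: swept c else swept c.
Proof.
move=> up; rewrite sweptE sweptE'.
have hE : (h' + 1 = h + bottom_kept D c + top_raised D c)%N by move: bE tE; clear; lia.
have [bt|bt] := boolP (bottom_kept D c).
  have -> : mkseq B' h' = c + 1 :: mkseq B h'.-1.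
    rewrite -[in LHS](prednK h'_gt0) /mkseq /= -add1n iotaDl -map_comp.
    congr cons; first by apply: fresh_start => //; rewrite up bE bt; clear; lia.
    apply/eq_in_map => t; rewrite mem_iota => lt_t /=.
    apply: moved; rewrite ?up ?bE ?bt; move: lt_t hE (bt); case: (top_raised D c); clear; lia.
  rewrite cat_cons; congr cons.
  have [tu|tu] := boolP (top_raised D c).
    by rewrite no_end; [congr (mkseq _ _ ++ _); move: hE; rewrite bt tu; clear; lia
      | move=> r; rewrite up; move: bE tE; rewrite bt tu; clear; lia].
  have hS : h = h'.-1.+1 by move: h'_gt0 hE; rewrite bt (negPf tu); clear; lia.
  rewrite (loose_end (t := h'.-1)); first by rewrite -cat_rcons hS mkseqS.
    by rewrite hS.
  by rewrite up; move: bE tE hS; rewrite bt (negPf tu); clear; lia.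
have BE t : (t < h)%N -> (t < h')%N -> B' t = B t.
  by move=> ? ?; apply: moved; rewrite ?up //; move: bE; rewrite (negPf bt); clear; lia.
have [tu|tu] := boolP (top_raised D c).
  rewrite no_end; last first.
    by move=> r; rewrite up; move: bE tE; rewrite (negPf bt) tu; clear; lia.
  have -> : h' = h by move: hE; rewrite (negPf bt) tu; clear; lia.
  congr (_ ++ _); apply/eq_in_map => t; rewrite mem_iota => lt_t.
  by apply: BE; move: lt_t hE; rewrite (negPf bt) tu; clear; lia.
have hS : h = h'.+1 by move: hE; rewrite (negPf bt) (negPf tu); clear; lia.
rewrite (loose_end (t := h')); last first.
- by rewrite up; move: bE tE hS; rewrite (negPf bt) (negPf tu); clear; lia.
- by rewrite hS.
rewrite hS mkseqS cat_rcons; congr (_ ++ _); apply/eq_in_map => t; rewrite mem_iota => lt_t.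
by apply: BE; move: lt_t hS; clear; lia.
Qed.

(** A strip [p] ending here stands at the front and has to move behind the whole
    diagonal; a new strip is inserted at the top, that is, between the diagonal and
    the finished strips. *)
Lemma swept_right : dir c = false ->
  if bottom_kept D c then
    exists s1 s2 : seq int, [/\ size s1 = h, swept c = s1 ++ s2 &
      swept (c + 1) = s1 ++ (if top_raised D c then c + 1 :: s2 else s2)]
  else
    exists (p : int) (s1 s2 : seq int), [/\ (size s1).+1 = h, swept c = p :: s1 ++ s2 &
      swept (c + 1) = s1 ++ (if top_raised D c then c + 1 :: p :: s2 else p :: s2)].
Proof.
move=> right; rewrite sweptE sweptE'.
have hE : (h' + 1 = h + bottom_kept D c + top_raised D c)%N by move: bE tE; clear; lia.
have top : top_raised D c -> B' h'.-1 = c + 1.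
  move=> tu; apply: fresh_start; first by rewrite ltn_predL.
  by rewrite right; move: tE h'_gt0; rewrite tu; clear; lia.
have [bt|bt] := boolP (bottom_kept D c).
  exists (mkseq B h), (ended c); rewrite size_mkseq; split=> //.
  have BE t : (t < h)%N -> (t < h')%N -> B' t = B t.
    by move=> ? ?; apply: moved; rewrite ?right //; move: bE; rewrite bt; clear; lia.
  rewrite no_end; last first.
    by move=> r; rewrite right; move: bE tE; rewrite bt; case: (top_raised D c); clear; lia.
  have [tu|tu] := boolP (top_raised D c); last first.
    have -> : h' = h by move: hE; rewrite bt (negPf tu); clear; lia.
    congr (_ ++ _); apply/eq_in_map => t; rewrite mem_iota => lt_t.
    by apply: BE; move: lt_t hE; rewrite bt (negPf tu); clear; lia.
  have hS : h' = h.+1 by move: hE; rewrite bt tu; clear; lia.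
  have := top tu; rewrite hS mkseqS cat_rcons => /= ->.
  congr (_ ++ _); apply/eq_in_map => t; rewrite mem_iota => lt_t.
  by apply: BE; move: lt_t hS; clear; lia.
exists (B 0%N), (mkseq (fun t => B t.+1) h.-1), (ended c).
rewrite size_mkseq prednK //; split=> //.
  by rewrite -[in LHS](prednK h_gt0) /mkseq /= -add1n iotaDl -map_comp.
rewrite (loose_end (t := 0%N)) //; last first.
  by rewrite right; move: bE; rewrite (negPf bt); clear; lia.
have BE t : (t.+1 < h)%N -> (t < h')%N -> B' t = B t.+1.
  by move=> ? ?; apply: moved; rewrite ?right //; move: bE; rewrite (negPf bt); clear; lia.
have [tu|tu] := boolP (top_raised D c).
  have hS : h' = h.-1.+1 by move: hE h_gt0; rewrite (negPf bt) tu; clear; lia.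
  have := top tu; rewrite hS mkseqS cat_rcons => /= ->.
  congr (_ ++ _); apply/eq_in_map => t; rewrite mem_iota => lt_t.
  by apply: BE; move: lt_t hS h_gt0; clear; lia.
have hS : h' = h.-1 by move: hE h_gt0; rewrite (negPf bt) (negPf tu); clear; lia.
rewrite hS; congr (_ ++ _); apply/eq_in_map => t; rewrite mem_iota => lt_t.
by apply: BE; move: lt_t hS h_gt0; clear; lia.
Qed.

(** If the heights agree, either nothing happens or a strip ends and another starts,
    and the two moves pass the same labels.  Otherwise one strip passes the strips
    that occupy both diagonals, and there are as many of these as boxes on the
    shorter one. *)
Definition right_move_parity : bool := (h != h') && odd (minn h h').

Lemma swept_perm : perm_eq (swept (c + 1)) (if starts_after c then c + 1 :: swept c else swept c).
Proof.
rewrite /starts_after; case: (boolP (dir c)) => [/swept_up -> // | /negPf /swept_right].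
case: (bottom_kept D c) => [[s1 [s2 [_ -> ->]]] | [p [s1 [s2 [_ -> ->]]]]].
  by case: (top_raised D c) => //; rewrite (perm_catCA s1 [:: c + 1] s2).
case: (top_raised D c); last by rewrite (perm_catCA s1 [:: p] s2).
by rewrite (perm_catCA s1 [:: c + 1; p] s2).
Qed.

Lemma swept_parity : uniq (swept c) -> {in swept c, forall p, p <= c} ->
  odd (ascents (swept (c + 1))) = odd (ascents (swept c)) (+) (~~ dir c && right_move_parity).
Proof.
move=> us le_c; have new0 s : {in s, forall p : int, p <= c} -> count (fun z => c + 1 < z) s = 0%N.
  move=> le_s; apply/eqP; rewrite -leqn0 leqNgt -has_count; apply/hasPn => p /le_s.
  by clear; lia.
have newN s : {in s, forall p : int, p <= c} -> c + 1 \notin s.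
  by move=> le_s; apply/negP=> /le_s; clear; lia.
have hE : (h' + 1 = h + bottom_kept D c + top_raised D c)%N by move: bE tE; clear; lia.
case: (boolP (dir c)) => [/swept_up -> | /negPf /swept_right] /=.
  by rewrite addbF; case: ifP => // _; rewrite /= new0.
rewrite /right_move_parity; case: ifP => bt; last first.
  case=> p [s1 [s2 [sz sE s'E]]]; rewrite s'E; rewrite sE in us le_c *.
  have /= /andP[ps _] := us.
  have ps1 : p \notin s1 by move: ps; rewrite mem_cat negb_or => /andP[].
  case: ifP => tu.
    have c1 : c + 1 \notin s1.
      by apply: newN => q qs; apply: le_c; rewrite inE mem_cat qs orbT.
    rewrite odd_ascents_move // [ascents (c + 1 :: _)]/= new0 ?add0n; last first.
      by move=> q; rewrite mem_cat inE => /or3P[] qs; apply: le_c; rewrite inE mem_cat qs ?orbT.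
    rewrite odd_ascents_move // -addbA addbb.
    by have -> : (h != h') = false by move: hE; rewrite bt tu; clear; lia.
  rewrite odd_ascents_move //; congr (_ (+) _).
  have hS : h = h'.+1 by move: hE; rewrite bt tu; clear; lia.
  have -> : (h != h') by rewrite hS; clear; lia.
  by have -> : minn h h' = size s1 by move: sz hS; clear; lia.
case=> s1 [s2 [sz sE s'E]]; rewrite s'E; rewrite sE in us le_c *.
case: ifP => tu; last first.
  have -> : (h != h') = false by move: hE; rewrite bt tu; clear; lia.
  by rewrite addbF.
rewrite odd_ascents_move; last by apply: newN => q qs; apply: le_c; rewrite mem_cat qs.
rewrite [ascents (c + 1 :: _)]/= new0 // add0n sz.
have hS : h' = h.+1 by move: hE; rewrite bt tu; clear; lia.
have -> : (h != h') by rewrite hS; clear; lia.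
by have -> : minn h h' = h by move: sz hS; clear; lia.
Qed.

Lemma start_after : (c + 1 \in [seq start_content th | th <- strips Pi]) = starts_after c.
Proof.
have loose_backE : (c + 1 \in [seq start_content th | th <- strips Pi]) <->
    (exists r, b' - h'%:Z < r <= b' /\ ~~ (b - h%:Z < r + (dir c)%:Z <= b)).
  split=> [/mapP[th] | [r [hr ends_on]]].
    rewrite mem_strips => thPi cE; have [x xth cx] := start_box thPi.
    have xD := outside_sub thPi xth.
    have := is_start thPi xth; rewrite cx eqxx -cE addrK [x in back x _]box_of_content.
    rewrite cx -cE back_box mem_c => /esym; exists x.1; split=> //.
    by rewrite -mem_c' cE -cx -box_of_content.
  rewrite -mem_c' in hr; have [th thPi xth] := outside_cover hr.
  apply/mapP; exists th; first by rewrite mem_strips.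
  have := is_start thPi xth; rewrite box_content addrK back_box mem_c ends_on.
  by move/eqP.
rewrite /starts_after; apply/idP/idP.
  case/loose_backE=> r; move: bE tE h_gt0 h'_gt0; case: (dir c) => /=;
  by case: (bottom_kept D c); case: (top_raised D c); clear; lia.
(* The new box is the bottom one if the boxes go up, the top one otherwise. *)
move=> new; apply/loose_backE; exists (if dir c then b' else b' - h'%:Z + 1).
move: new bE tE h_gt0 h'_gt0; case: (dir c) => -> /=;
by clear; lia.
Qed.

Lemma end_on : (c \in [seq end_content th | th <- strips Pi]) = ends_on c.
Proof.
have loose_stepE : (c \in [seq end_content th | th <- strips Pi]) <->
    (exists r, b - h%:Z < r <= b /\ ~~ (b' - h'%:Z < r - (dir c)%:Z <= b')).
  split=> [/mapP[th] | [r [hr ends_on]]].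
    rewrite mem_strips => thPi cE; have [x xth cx] := end_box thPi.
    have xD := outside_sub thPi xth.
    have := is_end thPi xth; rewrite cx eqxx -cE [x in step x _]box_of_content.
    rewrite cx -cE step_box mem_c' => /esym; exists x.1; split=> //.
    by rewrite -mem_c cE -cx -box_of_content.
  rewrite -mem_c in hr; have [th thPi xth] := outside_cover hr.
  apply/mapP; exists th; first by rewrite mem_strips.
  have := is_end thPi xth; rewrite box_content step_box mem_c' ends_on.
  by move/eqP.
rewrite /ends_on; apply/idP/idP.
  case/loose_stepE=> r; move: bE tE h_gt0 h'_gt0; case: (dir c) => /=;
  by case: (bottom_kept D c); case: (top_raised D c); clear; lia.
(* The strip ends in the top box if the boxes go up, in the bottom one otherwise. *)
move=> new; apply/loose_stepE; exists (if dir c then b - h%:Z + 1 else b).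
move: new bE tE h_gt0 h'_gt0; case: (dir c) => /negPf -> /=;
by clear; lia.
Qed.
End OneStep.

Local Notation starts := [seq start_content th | th <- strips Pi].
Local Notation ends := [seq end_content th | th <- strips Pi].

Lemma starts_uniq : uniq starts.
Proof.
rewrite map_inj_in_uniq ?strips_uniq // => th th'; rewrite !mem_strips.
exact: start_content_inj.
Qed.

Lemma lo_le_hi : lo <= hi.
Proof.
have /start_end_mem[[a aE ca] _] : D != fset0 by case/andP: D_conn.
by have := diagonals_bounds aE; rewrite ca => /andP[].
Qed.

Lemma starts_ge : {in starts, forall p, lo <= p <= hi}.
Proof.
move=> p /mapP[th]; rewrite mem_strips => /strip_bounds [h1 h2 h3] ->.
by rewrite h1 (le_trans h2).
Qed.

Lemma ends_le : {in ends, forall q, lo <= q <= hi}.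
Proof.
move=> p /mapP[th]; rewrite mem_strips => /strip_bounds [h1 h2 h3] ->.
by rewrite h3 (le_trans h1).
Qed.

Lemma ends_sorted : sorted (fun q q' => q' < q) ends.
Proof. by rewrite sorted_map strips_sorted. Qed.

Lemma lo_start : lo \in starts.
Proof.
have /start_end_mem[[x xD cx] _] : D != fset0 by case/andP: D_conn.
have [th thPi xth] := outside_cover xD; apply/mapP; exists th; first by rewrite mem_strips.
have [h1 _ _] := strip_bounds thPi; have := diagonals_bounds xth; move: h1; rewrite cx.
by clear; lia.
Qed.

Lemma hi_end : hi \in ends.
Proof.
have /start_end_mem[_ [x xD cx]] : D != fset0 by case/andP: D_conn.
have [th thPi xth] := outside_cover xD; apply/mapP; exists th; first by rewrite mem_strips.
have [_ _ h1] := strip_bounds thPi; have := diagonals_bounds xth; move: h1; rewrite cx.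
by clear; lia.
Qed.

Lemma swept_lo : swept lo = [:: lo].
Proof.
have lo_lo : lo <= lo <= hi by rewrite lexx lo_le_hi.
rewrite /swept (diagonal_rowsE D_convex D_conn lo_lo).2 height_lo //= subr0.
have mD : (bottom D lo, bottom D lo + lo) \in D.
  by rewrite mem_diagonal // height_lo //; clear; lia.
have [th thPi xth] := outside_cover mD; rewrite (strip_startE thPi xth).
have -> : start_content th = lo.
  have [h1 _ _] := strip_bounds thPi; have := diagonals_bounds xth; move: h1.
  by rewrite box_content; clear; lia.
congr cons; rewrite /ended (_ : [seq th <- _ | _] = [::]) //.
apply/eqP; rewrite -[_ == _]negbK -has_filter -all_predC; apply/allP => th'.
by rewrite mem_strips => /strip_bounds [] /=; clear; lia.
Qed.

(** The sweep adds each start when it reaches its content. *)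
Lemma sweptP c : lo <= c <= hi ->
  [/\ uniq (swept c), {in swept c, forall p, p <= c} &
      swept c =i [seq p <- starts | p <= c]].
Proof.
suff H (n : nat) : lo + n%:Z <= hi -> [/\ uniq (swept (lo + n%:Z)),
    {in swept (lo + n%:Z), forall p, p <= lo + n%:Z} &
    swept (lo + n%:Z) =i [seq p <- starts | p <= lo + n%:Z]].
  move=> hc; have cE : c = lo + `|c - lo|%N%:Z by move: hc; clear; lia.
  by rewrite cE; apply: H; rewrite -cE; case/andP: hc.
elim: n => [|n IH] le_n.
  rewrite addr0 swept_lo; split=> // p; rewrite ?inE ?mem_filter.
    by move=> /eqP ->; rewrite lexx.
  apply/eqP/andP => [-> | [le_p /starts_ge]]; first by rewrite lexx lo_start.
  by move: le_p; clear; lia.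
have [|us le_c sE] := IH; first by move: le_n; clear; lia.
set c' := lo + n%:Z in us le_c sE.
have -> : lo + n.+1%:Z = c' + 1 by rewrite /c'; clear; lia.
have [c1 c2] : lo <= c' /\ c' < hi by rewrite /c'; move: le_n; clear; lia.
have pE := swept_perm c1 c2; have memE := perm_mem pE.
split.
- rewrite (perm_uniq pE); case: ifP => //= _; rewrite us andbT.
  by apply/negP=> /le_c; clear; lia.
- move=> p; rewrite memE; case: ifP => _; last by move/le_c; clear; lia.
  by rewrite inE => /predU1P[->|/le_c]; clear; lia.
move=> p; rewrite memE mem_filter.
have -> : (p <= c' + 1) = (p == c' + 1) || (p <= c') by clear; lia.
have inE' : (p \in swept c') = (p <= c') && (p \in starts) by rewrite sE mem_filter.
have [->|np] := eqVneq p (c' + 1).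
  have -> : (c' + 1 \in starts) = starts_after c' by exact: start_after.
  case: ifP => [_|_]; first by rewrite mem_head.
  by apply/negP=> /le_c; clear; lia.
by case: ifP => _; rewrite ?inE ?(negPf np) inE'.
Qed.

Lemma swept_hi : swept hi = starts.
Proof.
have hi_hi : lo <= hi <= hi by rewrite lexx lo_le_hi.
rewrite /swept (diagonal_rowsE D_convex D_conn hi_hi).2 height_hi //= subr0.
have mD : (bottom D hi, bottom D hi + hi) \in D.
  by rewrite mem_diagonal // height_hi //; clear; lia.
rewrite -ended_loose //; last first.
  apply/negP => sD; have := diagonals_bounds sD; rewrite content_step box_content.
  by clear; lia.
congr map; apply/all_filterP/allP => th; rewrite mem_strips => /strip_bounds[_ _].
by clear; lia.
Qed.

(** Both sides count the strips that have begun by the diagonal [c], the left one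
    according to whether they have also ended. *)
Lemma count_starts_ends c : lo <= c <= hi ->
  (height D c + count (fun q => (q < c)%R) ends = count (fun p => (p <= c)%R) starts)%N.
Proof.
move=> hc; have [us _ sE] := sweptP hc.
have /perm_size e := uniq_perm us (filter_uniq _ starts_uniq) sE.
rewrite -[RHS]size_filter -e size_cat size_map; congr (_ + _)%N.
by rewrite size_map size_filter count_map.
Qed.
End Outside.

(** * Twisting one diagonal *)

Lemma mkseq_split (T : Type) (g : nat -> T) k n : (k < n)%N ->
  mkseq g n = mkseq g k ++ g k :: mkseq (fun t => g (k.+1 + t)%N) (n - k.+1).
Proof.
move=> lt_k; rewrite -cat_rcons -mkseqS /mkseq -[in LHS](subnKC lt_k) iotaD map_cat add0n.
by congr cat; rewrite -[X in iota X _]addn0 iotaDl -map_comp.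
Qed.

Lemma ascents_decreasing (s : seq int) : sorted (fun x y => y < x) s -> ascents s = 0%N.
Proof.
elim: s => //= x s IH xs; rewrite IH ?(path_sorted xs) // addn0.
have lt_trans' : transitive (fun x y : int => y < x).
  by move=> y1 y2 y3 h1 h2; exact: lt_trans h2 h1.
have /allP lt_x := order_path_min lt_trans' xs.
apply/eqP; rewrite -leqn0 leqNgt -has_count; apply/hasPn => y /lt_x /=.
by rewrite -leNgt; exact: ltW.
Qed.

Lemma sign_even (K : fieldType) n : ~~ odd n -> (-1) ^+ n = 1 :> K.
Proof. by move=> /negPf e; rewrite -signr_odd e. Qed.

Lemma decreasing_uniq (s : seq int) : sorted (fun x y => y < x) s -> uniq s.
Proof.
apply: (sorted_uniq (leT := fun x y : int => y < x)); last by move=> y; exact: ltxx.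
by move=> y1 y2 y3 h1 h2; exact: lt_trans h2 h1.
Qed.

Section Directions.
Variables (D : {fset box}) (Pi : {fset {fset box}}).
Hypothesis D_conn : edgewise_connected D.
Local Notation lo := (start_content D).
Local Notation hi := (end_content D).

Lemma directionsE :
  directions D Pi = mkseq (fun t => diagonal_goes_up D Pi (lo + t%:Z)) `|hi - lo|.
Proof.
rewrite /directions diagonals_connected // size_mkseq /= map_take.
set n := `|_|%N; rewrite -map_comp -map_take take_iota.
by have -> : minn n n.+1 = n by lia.
Qed.

Lemma flip_directionE i (g : nat -> bool) :
  flip_direction D i (mkseq g `|hi - lo|) =
  mkseq (fun t => g t (+) (lo + t%:Z == i)) `|hi - lo|.
Proof.
rewrite /flip_direction diagonals_connected //; set n := `|_|%N.
apply: (@eq_from_nth _ false) => [|t]; rewrite size_map size_zip !size_mkseq.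
  by lia.
move=> lt_t; rewrite (nth_map (0, false)) ?size_zip ?size_mkseq //.
rewrite nth_zip_cond size_zip !size_mkseq lt_t /= !nth_mkseq //; lia.
Qed.

Lemma strip_matrixE n : size (strips Pi) = n ->
  mx (strip_matrix D Pi) =
  mx (labelled_mx n (schur_entry lo (directions D Pi))
        [seq end_content th | th <- strips Pi] [seq start_content th | th <- strips Pi]).
Proof.
move=> <-; congr mx; apply/matrixP => r c; rewrite !mxE.
by rewrite !(nth_map fset0).
Qed.
End Directions.

Lemma twist_directions D i Pi Pi' : edgewise_connected D -> is_twist D i Pi Pi' ->
  forall c, start_content D <= c -> c < end_content D ->
  diagonal_goes_up D Pi' c = diagonal_goes_up D Pi c (+) (c == i).
Proof.
move=> conn [_]; rewrite /cutting_strip !directionsE // flip_directionE //.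
move/strip_along_inj; rewrite !size_mkseq => /(_ erefl) e c c1 c2.
have lt_c : (`|c - start_content D| < `|end_content D - start_content D|)%N by lia.
have /(congr1 (fun s => nth false s `|c - start_content D|)) := e.
rewrite !nth_mkseq //.
by have -> : start_content D + `|c - start_content D|%N%:Z = c by lia.
Qed.

Section Pair.
Variable D : {fset box}.
Hypotheses (D_convex : convex D) (D_conn : edgewise_connected D).
Local Notation lo := (start_content D).
Local Notation hi := (end_content D).
Local Notation ends Pi := [seq end_content th | th <- strips Pi].
Local Notation starts Pi := [seq start_content th | th <- strips Pi].

Lemma mem_starts Pi (p : int) : outside_decomposition D Pi ->
  (p \in starts Pi) = (p == lo) || (lo < p <= hi) && starts_after D Pi (p - 1).
Proof.
move=> outPi; have [-> | p_lo] := eqVneq p lo; first exact: lo_start.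
have [hp | hp] /= := boolP (lo < p <= hi).
  have {1}-> : p = p - 1 + 1 by lia.
  by rewrite (start_after D_convex D_conn outPi) //; lia.
by apply/negP => /(starts_ge outPi); lia.
Qed.

Lemma mem_ends Pi (q : int) : outside_decomposition D Pi ->
  (q \in ends Pi) = (q == hi) || (lo <= q < hi) && ends_on D Pi q.
Proof.
move=> outPi; have [-> | q_hi] := eqVneq q hi; first exact: hi_end.
have [hq | hq] /= := boolP (lo <= q < hi); first by rewrite (end_on D_convex D_conn outPi) //; lia.
by apply/negP => /(ends_le outPi); lia.
Qed.

Lemma ends_eq Pi Pi' : outside_decomposition D Pi -> outside_decomposition D Pi' ->
  ends Pi =i ends Pi' -> ends Pi = ends Pi'.
Proof.
move=> outPi outPi'; apply: (irr_sorted_eq (leT := fun x y : int => y < x)).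
- by move=> y1 y2 y3 h1 h2; exact: lt_trans h2 h1.
- by move=> y; exact: ltxx.
- exact: (ends_sorted D_convex D_conn outPi).
- exact: (ends_sorted D_convex D_conn outPi').
Qed.

Variables (Pi Pi' : {fset {fset box}}) (i : int).
Hypotheses (outPi : outside_decomposition D Pi) (outPi' : outside_decomposition D Pi').
Hypothesis (lo_i : lo <= i).
Hypothesis twisted : forall c, lo <= c -> c < hi ->
  diagonal_goes_up D Pi' c = diagonal_goes_up D Pi c (+) (c == i).

(** Away from the diagonal [i] both sweeps contribute the same signs. *)
Lemma ascents_twist : odd (ascents (starts Pi')) =
  odd (ascents (starts Pi)) (+) ((i < hi) && right_move_parity D i).
Proof.
rewrite -(swept_hi D_convex D_conn outPi) -(swept_hi D_convex D_conn outPi').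
suff H (n : nat) : lo + n%:Z <= hi -> odd (ascents (swept D Pi' (lo + n%:Z))) =
    odd (ascents (swept D Pi (lo + n%:Z))) (+) ((i < lo + n%:Z) && right_move_parity D i).
  have := lo_le_hi D_conn => le_lohi.
  by have := H `|hi - lo|%N; have -> : lo + `|hi - lo|%N%:Z = hi; [lia | apply].
elim: n => [|n IH] le_n.
  rewrite addr0 (swept_lo D_convex D_conn outPi) (swept_lo D_convex D_conn outPi').
  by have -> : (i < lo) = false by lia.
have -> : lo + n.+1%:Z = lo + n%:Z + 1 by lia.
have {}IH := IH ltac:(lia); set c := lo + n%:Z in IH *.
have [c1 c2] : lo <= c /\ c < hi by lia.
have in_c : lo <= c <= hi by lia.
have [u1 u2 _] := sweptP D_convex D_conn outPi in_c.
have [u1' u2' _] := sweptP D_convex D_conn outPi' in_c.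
rewrite (swept_parity D_convex D_conn outPi) // (swept_parity D_convex D_conn outPi') //.
rewrite IH twisted //.
have -> : (i < c + 1) = (c == i) || (i < c) by lia.
case: eqP => [-> | _] /=; last by rewrite addbF addbAC.
rewrite ltxx /= addbF; case: (diagonal_goes_up _ _ _) => /=;
by rewrite ?addbF ?addbT -?addbA ?addbb ?addbF.
Qed.

Lemma starts_perm : (forall p, (p \in starts Pi) = (p \in starts Pi')) ->
  perm_eq (starts Pi) (starts Pi').
Proof. by move=> h; apply: uniq_perm h; apply: (starts_uniq D_convex D_conn); eassumption. Qed.

Lemma fresh_other c : lo <= c -> c < hi -> c != i -> starts_after D Pi' c = starts_after D Pi c.
Proof. by move=> c1 c2 /negPf ci; rewrite /starts_after twisted // ci addbF. Qed.

Lemma loose_other c : lo <= c -> c < hi -> c != i -> ends_on D Pi' c = ends_on D Pi c.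
Proof. by move=> c1 c2 /negPf ci; rewrite /ends_on twisted // ci addbF. Qed.

Lemma starts_other p : p != i + 1 -> (p \in starts Pi') = (p \in starts Pi).
Proof.
move=> pi; rewrite !mem_starts //; case: eqP => //= p_lo.
by case: (boolP (lo < p <= hi)) => //= hp; rewrite fresh_other //; lia.
Qed.

Lemma ends_other q : q != i -> (q \in ends Pi') = (q \in ends Pi).
Proof.
move=> qi; rewrite !mem_ends //; case: eqP => //= q_hi.
by case: (boolP (lo <= q < hi)) => //= hq; rewrite loose_other //; lia.
Qed.

Local Notation f := (schur_entry lo (directions D Pi)).
Local Notation f' := (schur_entry lo (directions D Pi')).

Lemma size_ends : size (ends Pi) = size (strips Pi). Proof. by rewrite size_map. Qed.
Lemma size_starts : size (starts Pi) = size (strips Pi). Proof. by rewrite size_map. Qed.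

Lemma reachable_same_labels m sg :
  ends Pi' = ends Pi -> perm_eq (starts Pi) (starts Pi') -> m = size (strips Pi) ->
  odd sg = (i < hi) && right_move_parity D i ->
  ops is_symmetric_function (labelled_mx m f (ends Pi) (starts Pi)) ((-1) ^+ sg)
    (labelled_mx m f' (ends Pi) (starts Pi)) ->
  det_obtainable is_symmetric_function (strip_matrix D Pi) (strip_matrix D Pi').
Proof.
move=> endsE pE mE sgE h; rewrite /det_obtainable (strip_matrixE D (esym mE)).
have mE' : size (strips Pi') = m.
  by rewrite mE -size_ends -endsE size_map.
rewrite (strip_matrixE D mE') endsE.
have usts := starts_uniq D_convex D_conn outPi.
have sz : size (starts Pi) = m by rewrite size_starts.
have h2 := ops_perm_cols is_symmetric_function (t := [::]) f' (ends Pi) pE usts sz.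
have := ops_reachable 1 [::] [::] (ops_trans h h2).
rewrite mul1r -exprD sign_even //.
rewrite !oddD ascents_twist sgE.
by case: (odd _); case: (_ && _).
Qed.

(** The last diagonal has no direction in the cutting strip; the decompositions have
    the same matrix up to an even permutation of columns. *)
Lemma det_obtainable_last : i = hi ->
  det_obtainable is_symmetric_function (strip_matrix D Pi) (strip_matrix D Pi').
Proof.
move=> iE.
have endsE : ends Pi' = ends Pi.
  apply: ends_eq => // q; have [-> | /ends_other //] := eqVneq q i.
  by rewrite iE (hi_end D_conn outPi) (hi_end D_conn outPi').
have pE : perm_eq (starts Pi) (starts Pi').
  apply: starts_perm => p; have [-> | /starts_other //] := eqVneq p (i + 1).
  rewrite !mem_starts //; have -> : (lo < i + 1 <= hi) = false by rewrite iE; clear; lia.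
  by [].
apply: (reachable_same_labels (sg := 0) endsE pE erefl); first by rewrite iE ltxx.
have -> : directions D Pi' = directions D Pi; last exact: OpsRefl.
rewrite !directionsE //; apply/eq_in_map => t; rewrite mem_iota => lt_t.
have := lo_le_hi D_conn => le_lohi.
rewrite twisted; [ | by clear; lia | by move: lt_t le_lohi; clear; lia].
have -> : (lo + t%:Z == i) = false; last by rewrite addbF.
by move: lt_t le_lohi; rewrite iE; clear; lia.
Qed.

Hypothesis i_hi : i < hi.

Let k := `|i - lo|%N.
Let u1 := mkseq (fun t => diagonal_goes_up D Pi (lo + t%:Z)) k.
Let u2 := mkseq (fun t => diagonal_goes_up D Pi (lo + (k.+1 + t)%N%:Z)) (`|hi - lo| - k.+1).

Let lt_k : (k < `|hi - lo|)%N. Proof. by rewrite /k; move: lo_i i_hi; clear; lia. Qed.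
Let iE : lo + (size u1)%:Z = i.
Proof. by rewrite size_mkseq /k; move: lo_i; clear; lia. Qed.

Let dirsE : directions D Pi = u1 ++ diagonal_goes_up D Pi i :: u2.
Proof.
rewrite directionsE // (mkseq_split _ lt_k); congr (_ ++ diagonal_goes_up _ _ _ :: _).
by rewrite -[RHS]iE size_mkseq.
Qed.

Let dirsE' : directions D Pi' = u1 ++ ~~ diagonal_goes_up D Pi i :: u2.
Proof.
have E t : (t < `|hi - lo|)%N -> diagonal_goes_up D Pi' (lo + t%:Z) =
    diagonal_goes_up D Pi (lo + t%:Z) (+) (t == k).
  move=> lt_t; rewrite twisted; [ | by clear; lia | by move: lt_t lo_i i_hi; clear; lia].
  by congr (_ (+) _); rewrite /k; move: lo_i; clear; lia.
rewrite directionsE // (mkseq_split _ lt_k); congr (_ ++ _ :: _).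
- apply/eq_in_map => t; rewrite mem_iota => lt_t.
  have -> : diagonal_goes_up D Pi' (lo + t%:Z) = diagonal_goes_up D Pi (lo + t%:Z) (+) (t == k).
    by apply: E; move: lt_t lt_k; clear; lia.
  by have -> : (t == k) = false; [move: lt_t; clear; lia | rewrite addbF].
- rewrite E // eqxx addbT; congr (~~ diagonal_goes_up _ _ _).
  by rewrite -[RHS]iE size_mkseq.
apply/eq_in_map => t; rewrite mem_iota => lt_t.
rewrite E; last by move: lt_t lt_k; clear; lia.
by have -> : (k.+1 + t == k)%N = false; [clear; lia | rewrite addbF].
Qed.

Let hiE : lo + (size (directions D Pi))%:Z = hi.
Proof. by rewrite directionsE // size_mkseq; have := lo_le_hi D_conn; clear; lia. Qed.

Lemma entry_low p q : lo <= p -> q <= i -> f' p q = f p q.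
Proof.
move=> ? ?; rewrite dirsE dirsE'.
by rewrite (@schur_entry_low lo u1 u2 (diagonal_goes_up D Pi i)) ?iE.
Qed.

Lemma entry_high p q : i + 1 <= p -> q <= hi -> f' p q = f p q.
Proof.
move=> ? ?; rewrite dirsE dirsE' (@schur_entry_high lo u1 u2 (diagonal_goes_up D Pi i)) ?iE //.
by rewrite -dirsE hiE.
Qed.

Lemma entry_split p q : lo <= p <= i -> i < q <= hi -> f p i * f (i + 1) q = f p q + f' p q.
Proof.
move=> hp hq; rewrite dirsE dirsE'.
have := @schur_entry_split lo u1 u2 _ _ p q (erefl (~~ diagonal_goes_up D Pi i)).
by rewrite iE -dirsE hiE; apply.
Qed.

Lemma entry_symmetric p q : lo <= p -> q <= hi -> is_symmetric_function (f p q).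
Proof. by move=> ? ?; apply: schur_entry_symmetric; rewrite ?hiE. Qed.

(** A strip ending after [i] either passes through one of the boxes on the diagonal
    [i + 1] or starts later. *)
Lemma count_crossing :
  (count (fun q => (i < q)%R) (ends Pi) =
   height D (i + 1) + count (fun p => (i + 1 < p)%R) (starts Pi))%N.
Proof.
have in_i : lo <= i + 1 <= hi by move: lo_i i_hi; clear; lia.
have e0 : (height D (i + 1) + count (fun q => (q < i + 1)%R) (ends Pi) =
    count (fun p => (p <= i + 1)%R) (starts Pi))%N by exact: count_starts_ends.
have e1 : (count (fun q => (q < i + 1)%R) (ends Pi) +
    count (fun q => (i < q)%R) (ends Pi) = size (strips Pi))%N.
  rewrite -size_ends -(count_predC (fun q => q < i + 1) (ends Pi)); congr (_ + _)%N.
  by apply: eq_count => q /=; rewrite -leNgt; clear; lia.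
have e2 : (count (fun p => (p <= i + 1)%R) (starts Pi) +
    count (fun p => (i + 1 < p)%R) (starts Pi) = size (strips Pi))%N.
  rewrite -size_starts -(count_predC (fun p => p <= i + 1) (starts Pi)); congr (_ + _)%N.
  by apply: eq_count => p /=; rewrite -ltNge.
by move: e0 e1 e2; clear; lia.
Qed.

(** The diagonal gets shorter: the row ending at [i] is there before and after. *)
Lemma det_obtainable_end : ~~ bottom_kept D i -> ~~ top_raised D i ->
  det_obtainable is_symmetric_function (strip_matrix D Pi) (strip_matrix D Pi').
Proof.
move=> /negPf bF /negPf tF.
have hE := height_succ D_convex D_conn lo_i i_hi; rewrite bF tF in hE.
have iQ P : outside_decomposition D P -> i \in ends P.
  by move=> outP; rewrite mem_ends // lo_i i_hi /ends_on bF tF; case: ifP; rewrite orbT.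
have iP P : outside_decomposition D P -> i + 1 \notin starts P.
  move=> outP; rewrite mem_starts // addrK /starts_after bF tF if_same andbF orbF.
  by move: lo_i; clear; lia.
have endsE : ends Pi' = ends Pi.
  apply: ends_eq => // q; have [-> | /ends_other //] := eqVneq q i.
  by rewrite !iQ.
have pE : perm_eq (starts Pi) (starts Pi').
  apply: starts_perm => p; have [-> | /starts_other //] := eqVneq p (i + 1).
  by rewrite (negPf (iP _ outPi)) (negPf (iP _ outPi')).
apply: (reachable_same_labels endsE pE erefl); last first.
  apply: (twist_at_end lo_i i_hi entry_low entry_high entry_split) => //.
  - by move=> p q; exact: schur_entry_undef.
  - exact: entry_symmetric.
  - exact: size_ends.
  - exact: size_starts.
  - by move=> q /(ends_le outPi) /andP[].
  - by move=> p /(starts_ge outPi) /andP[].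
  - by have := ends_sorted D_convex D_conn outPi; exact: decreasing_uniq.
  - exact: iQ.
  - exact: iP.
(* Both the negations and the permutation of the columns contribute the parity of
   the number of boxes on the shorter diagonal [i + 1]. *)
rewrite i_hi count_crossing /right_move_parity -addnA addnn oddD odd_double addbF.
have -> : (height D i != height D (i + 1)) by move: hE; clear; lia.
by have -> : minn (height D i) (height D (i + 1)) = height D (i + 1) by move: hE; clear; lia.
Qed.

(** The diagonal gets longer: the column starting at [i + 1] is there before and
    after. *)
Lemma det_obtainable_start : bottom_kept D i -> top_raised D i ->
  det_obtainable is_symmetric_function (strip_matrix D Pi) (strip_matrix D Pi').
Proof.
move=> bT tT.
have hE := height_succ D_convex D_conn lo_i i_hi; rewrite bT tT in hE.
have iQ P : outside_decomposition D P -> i \notin ends P.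
  move=> outP; rewrite mem_ends // lo_i i_hi /ends_on bT tT if_same orbF.
  by move: i_hi; clear; lia.
have iP P : outside_decomposition D P -> i + 1 \in starts P.
  move=> outP; rewrite mem_starts // addrK /starts_after bT tT if_same andbT.
  by move: lo_i i_hi; clear; lia.
have endsE : ends Pi' = ends Pi.
  apply: ends_eq => // q; have [-> | /ends_other //] := eqVneq q i.
  by rewrite (negPf (iQ _ outPi)) (negPf (iQ _ outPi')).
have pE : perm_eq (starts Pi) (starts Pi').
  apply: starts_perm => p; have [-> | /starts_other //] := eqVneq p (i + 1).
  by rewrite !iP.
apply: (reachable_same_labels endsE pE erefl); last first.
  apply: (twist_at_start lo_i i_hi entry_low entry_high entry_split) => //.
  - by move=> p q; exact: schur_entry_undef.
  - exact: entry_symmetric.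
  - exact: size_ends.
  - exact: size_starts.
  - by move=> q /(ends_le outPi) /andP[].
  - by move=> p /(starts_ge outPi) /andP[].
  - exact: starts_uniq outPi.
  - exact: iP.
  - exact: iQ.
have in_i : lo <= i <= hi by move: lo_i i_hi; clear; lia.
rewrite i_hi -(count_starts_ends D_convex D_conn outPi in_i) addnCA addnn oddD odd_double addbF.
rewrite /right_move_parity; have -> : (height D i != height D (i + 1)) by move: hE; clear; lia.
by have -> : minn (height D i) (height D (i + 1)) = height D i by move: hE; clear; lia.
Qed.

(** The twist creates a strip ending at [i] and one starting at [i + 1].  Putting the
    new row and column in their places costs as many signs as the negations of
    [twist_new], so these cancel. *)
Lemma det_obtainable_grow : bottom_kept D i != top_raised D i -> ~~ starts_after D Pi i ->
  det_obtainable is_symmetric_function (strip_matrix D Pi) (strip_matrix D Pi').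
Proof.
move=> bt newF.
have hE := height_succ D_convex D_conn lo_i i_hi.
have [looseF newT looseT] : [/\ ~~ ends_on D Pi i, starts_after D Pi' i & ends_on D Pi' i].
  move: newF bt; rewrite /starts_after /ends_on twisted // eqxx addbT.
  by case: (diagonal_goes_up D Pi i); case: (bottom_kept D i); case: (top_raised D i).
have iQ : i \notin ends Pi.
  by rewrite mem_ends // (negPf looseF) andbF orbF; move: i_hi; clear; lia.
have iP : i + 1 \notin starts Pi.
  by rewrite mem_starts // addrK (negPf newF) andbF orbF; move: lo_i; clear; lia.
have iQ' : i \in ends Pi' by rewrite mem_ends // looseT lo_i i_hi orbT.
have iP' : i + 1 \in starts Pi'.
  by rewrite mem_starts // addrK newT andbT; move: lo_i i_hi; clear; lia.
have usts := starts_uniq D_convex D_conn outPi.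
have usts' := starts_uniq D_convex D_conn outPi'.
have s_ends := ends_sorted D_convex D_conn outPi.
have s_ends' := ends_sorted D_convex D_conn outPi'.
have pQ : perm_eq (i :: ends Pi) (ends Pi').
  apply: uniq_perm; first by rewrite /= iQ decreasing_uniq.
    exact: decreasing_uniq.
  by move=> q; rewrite inE; have [-> | /ends_other] := eqVneq q i.
have pP : perm_eq (i + 1 :: starts Pi) (starts Pi').
  apply: uniq_perm => //; first by rewrite /= iP usts.
  by move=> p; rewrite inE; have [-> | /starts_other] := eqVneq p (i + 1).
set n := size (strips Pi).
have sz' : size (strips Pi') = n.+1.
  by rewrite -(size_map end_content) -(perm_size pQ) /= size_ends.
rewrite /det_obtainable (strip_matrixE D (erefl n)) (strip_matrixE D sz').
have h1 := twist_new lo_i i_hi entry_low entry_high entry_split (schur_entry_empty _ _ _)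
  (@schur_entry_undef _ _) entry_symmetric size_ends size_starts
  (fun q qQ => proj2 (andP (ends_le outPi qQ)))
  (fun p pP => proj1 (andP (starts_ge outPi pP))) iQ iP.
apply: (reachable_trans h1).
have uQ : uniq (i :: ends Pi) by rewrite /= iQ decreasing_uniq.
have uP : uniq (i + 1 :: starts Pi) by rewrite /= iP usts.
have szQ : size (i :: ends Pi) = n.+1 by rewrite /= size_ends.
have szP : size (i + 1 :: starts Pi) = n.+1 by rewrite /= size_starts.
have h2 := ops_perm is_symmetric_function f' pQ uQ szQ pP uP szP.
have := ops_reachable ((-1) ^+ (count (fun q => i < q) (ends Pi) +
   count (fun p => i + 1 < p) (starts Pi))) [::] [::] h2.
rewrite -exprD [X in reachable _ _ (X, _)]sign_even //.
rewrite /= !(ascents_decreasing s_ends) (ascents_decreasing s_ends') !addn0 !oddD ascents_twist.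
have -> : right_move_parity D i = false.
  rewrite /right_move_parity; move: hE bt.
  by case: (bottom_kept D i); case: (top_raised D i) => //=; clear; lia.
by rewrite andbF addbF; do 3 case: (odd _).
Qed.
End Pair.

Theorem theorem3p3 (k : nat) (lam mu : k.-tuple nat)
    (hlam : partition_pair lam mu)
    (hconn : edgewise_connected (skew_shape lam mu))
    (Pi : {fset {fset box}})
    (hPi : outside_decomposition (skew_shape lam mu) Pi)
    (i : int) (hi : i \in diagonals (skew_shape lam mu))
    (omega_Pi : {fset {fset box}})
    (homega : is_twist (skew_shape lam mu) i Pi omega_Pi) :
  det_obtainable is_symmetric_function
    (strip_matrix (skew_shape lam mu) Pi)
    (strip_matrix (skew_shape lam mu) omega_Pi).
Proof.
have conv := skew_shape_convex hlam.
have outO : outside_decomposition (skew_shape lam mu) omega_Pi by case: homega.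
have dirs := twist_directions hconn homega; move: dirs hi => {homega}.
set D := skew_shape lam mu in hconn hPi conv outO *.
move=> dirs /mem_diagonals[x /diagonals_bounds + xi]; rewrite xi => /andP[lo_i].
rewrite le_eqVlt => /predU1P[i_last | i_lt].
  exact: (det_obtainable_last conv hconn hPi outO lo_i dirs i_last).
have [bt | bt] := eqVneq (bottom_kept D i) (top_raised D i).
  have [tT | tF] := boolP (top_raised D i); rewrite ?tT ?(negPf tF) in bt.
    exact: (det_obtainable_start conv hconn hPi outO lo_i dirs i_lt).
  by apply: (det_obtainable_end conv hconn hPi outO lo_i dirs i_lt); rewrite ?bt.
have [newT | newF] := boolP (starts_after D Pi i); last first.
  exact: (det_obtainable_grow conv hconn hPi outO lo_i dirs i_lt).
(* The twist back from [omega_Pi] is one that creates two strip ends. *)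
apply: (reachable_sym symmetric_functionN).
apply: (det_obtainable_grow conv hconn outO hPi lo_i _ i_lt bt).
  by move=> c c1 c2; rewrite dirs // -addbA addbb addbF.
move: bt newT; rewrite /starts_after dirs // eqxx addbT.
by case: (diagonal_goes_up D Pi i); case: (bottom_kept D i); case: (top_raised D i).
Qed.
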